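(* 1. Every vector measure space is a linear isomorphic mod $0$ image of a vector space with a free continuous measure. Thus a free measure plays the role of a universal object in the category of vector measure spaces. 2. Every measure-preserving automorphism of a space with a free measure is a mod $0$ linear automorphism of the space. Thus the group of all automorphism classes of a Lebesgue space with a continuous measure is a subgroup of the group of linear automorphisms of a space with a free measure. 3. Every measurable partition of a space with a free measure coincides mod $0$ with the partition into the cosets of some vector subspace. Thus the lattice of all classes of measurable partitions of a Lebesgue space with a continuous measure is a sublattice of the lattice of affine partitions of the vector space.
   Context: All vector spaces are real. A vector measure space is a triple $(E,\mathcal A,\mu)$ (written $(E,\mu)$), where $E$ is a vector space with a fixed linear space of linear homomorphisms $E\to\mathbb R^n$, $n\in\mathbb N$, separating the points of $E$ (every nonzero point has a nonzero image under at least one of them), $\mathcal A$ is the $\sigma$-algebra generated by the inverse images of Borel sets of $\mathbb R^n$ under these homomorphisms, and $\mu$ is a probability measure on $\mathcal A$ such that $(E,\mathcal A,\mu)$ is isomorphic as a measure space to a Lebesgue--Rokhlin space. The category of vector measure spaces has these triples as objects; a morphism is a measure-preserving linear map defined on a linear set of full measure. Morphisms are considered mod $0$, so a vector measure space is defined only up to choosing a vector subspace of full measure. Isomorphisms are invertible morphisms, and a linear automorphism is an isomorphism of a vector measure space with itself. A linear isomorphic mod $0$ image of a vector measure space means its image under a measure-preserving linear map (a morphism, mod $0$) that is simultaneously an isomorphism mod $0$ of the underlying measure spaces; such a map need not be an isomorphism of vector measure spaces, since its measurable inverse need not be linear. A measure in a vector space is called free if every measurable functional (real measurable function) on the space is linear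 up to a correction on a set of zero measure depending, in general, on the functional; that is, it coincides almost everywhere with a function that is linear in the ordinary sense on some vector subspace of full measure. A measure is continuous if it has no atoms. A measure-preserving automorphism is an invertible mod $0$ measure-preserving transformation; measurable partitions are meant in the sense of Rokhlin; classes of automorphisms and of partitions are taken with respect to coincidence mod $0$ (i.e., up to sets of zero measure). An affine partition of a vector space is a partition into the cosets of a vector subspace.
   Formalization: In 1 the free measure is claimed continuous only if the given space's measure is (a space with an atom is no isomorphic mod 0 image of a continuous one); in 3 affine partitions are taken mod 0, with meets only among the measurable ones, since the meet claim fails among all affine partitions. *)

(* Defs.v *)
From HB Require Import structures.
From mathcomp Require Import all_boot all_order all_algebra.
From mathcomp Require Import all_classical all_reals all_analysis.

Set Implicit Arguments.
Unset Strict Implicit.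
Unset Printing Implicit Defensive.

Import Order.TTheory GRing.Theory Num.Theory.
Import numFieldNormedType.Exports.

Local Open Scope classical_set_scope.
Local Open Scope ring_scope.

(* Lebesgue-Rokhlin spaces are complete, whereas the measurable types below
   carry the generated sigma-algebra only; so "measurable" in a notion taken
   mod 0 always means "in the completion", i.e. measurable up to a negligible
   set. A map defined on a set of full measure is represented by a total
   function, whose values outside that set are irrelevant. *)
Section mod0.
Context (R : realType).

Definition full d (T : measurableType d) (mu : probability T R) (A : set T) :=
  mu.-negligible (~` A).

Definition measurable0 d (T : measurableType d) (mu : probability T R)
    (A : set T) :=
  exists2 B, measurable B & mu.-negligible (A `+` B).

Definition eq0 d (T : measurableType d) (mu : probability T R) (U : Type)
    (f g : T -> U) :=
  {ae mu, forall x, f x = g x}.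

Definition measure_preserving0 d1 d2 (T1 : measurableType d1)
    (T2 : measurableType d2) (mu1 : probability T1 R) (mu2 : probability T2 R)
    (f : T1 -> T2) :=
  forall B, measurable B ->
    exists A, [/\ measurable A, mu1.-negligible ((f @^-1` B) `+` A) &
                  mu1 A = mu2 B].

Definition iso0 d1 d2 (T1 : measurableType d1) (T2 : measurableType d2)
    (mu1 : probability T1 R) (mu2 : probability T2 R) (f : T1 -> T2) :=
  measure_preserving0 mu1 mu2 f /\
  exists g : T2 -> T1,
    [/\ measure_preserving0 mu2 mu1 g, eq0 mu1 (g \o f) id &
        eq0 mu2 (f \o g) id].

Definition automorphism0 d (T : measurableType d) (mu : probability T R)
    (f : T -> T) :=
  iso0 mu mu f.

(* Up to isomorphism mod 0: an interval [0, c] with Lebesgue measure together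
   with at most countably many atoms, placed at the points n + 2 with masses
   w n. A null mass means that the atom is absent; c <= 1 is automatic, as Q
   has total mass 1. *)
Definition lebesgue_rokhlin d (T : measurableType d) (mu : probability T R) :=
  exists (Q : probability (measurableTypeR R) R) (c : R) (w : nat -> R),
    [/\ 0 <= c, (forall n, 0 <= w n),
        (forall B : set (measurableTypeR R), measurable B ->
          Q B = (lebesgue_measure (B `&` [set t | 0 <= t <= c]%R) +
                 \sum_(0 <= n <oo) (w n)%:E * \d_(n.+2%:R : R) B)%E) &
        exists f : T -> measurableTypeR R, iso0 mu Q f].

Definition atom d (T : measurableType d) (mu : probability T R) (A : set T) :=
  [/\ measurable A, (0 < mu A)%E &
      forall B, measurable B -> B `<=` A -> mu B = 0%E \/ mu B = mu A].

Definition atomless d (T : measurableType d) (mu : probability T R) :=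
  ~ exists A, atom mu A.

End mod0.

(* A partition is given by the set of its elements. *)
Section partitions.
Context (R : realType) d (T : measurableType d) (mu : probability T R).

(* measurable in the sense of Rokhlin: countably many measurable unions of
   elements separate the elements *)
Definition measurable_partition (P : set (set T)) :=
  partition P id setT /\
  exists B : nat -> set T,
    [/\ forall n, measurable0 mu (B n),
        forall n C, P C -> C `<=` B n \/ C `<=` ~` B n &
        forall C D, P C -> P D -> C <> D -> exists n,
          (C `<=` B n /\ D `<=` ~` B n) \/ (D `<=` B n /\ C `<=` ~` B n)].

Definition same_element (P : set (set T)) (x y : T) :=
  exists2 C, P C & C x /\ C y.

Definition refines0 (P Q : set (set T)) :=
  exists2 Y, full mu Y &
    forall x y, Y x -> Y y -> same_element P x y -> same_element Q x y.

Definition eq_partition0 (P Q : set (set T)) :=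
  exists2 Y, full mu Y &
    forall x y, Y x -> Y y -> (same_element P x y <-> same_element Q x y).

(* Lattice operations on classes mod 0 of partitions belonging to K. As is
   customary for measurable partitions, finer is larger. *)
Definition is_join0 (K : set (set (set T))) (P Q J : set (set T)) :=
  [/\ K J, refines0 J P, refines0 J Q &
      forall J', K J' -> refines0 J' P -> refines0 J' Q -> refines0 J' J].

Definition is_meet0 (K : set (set (set T))) (P Q M : set (set T)) :=
  [/\ K M, refines0 P M, refines0 Q M &
      forall M', K M' -> refines0 P M' -> refines0 Q M' -> refines0 M M'].

End partitions.

Section linear.
Context (R : realType).

Definition subspace_of (E : lmodType R) (L : set E) := submod_closed [in L].

Definition linear_on (E F : lmodType R) (L : set E) (f : E -> F) :=
  forall (a : R) x y, L x -> L y -> f (a *: x + y) = a *: f x + f y.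

Definition cosets (E : lmodType R) (L : set E) : set (set E) :=
  [set C | exists x, C = [set y | L (y - x)]].

Definition affine_partition (E : lmodType R) (P : set (set E)) :=
  exists2 L, subspace_of L & P = cosets L.

Definition borel_rV n : set (set 'rV[R]_n) := <<s open >>.

Definition cylinders (E : lmodType R) (H : forall n, set (E -> 'rV[R]_n)) :
    set (set E) :=
  [set A | exists n (h : E -> 'rV[R]_n) (B : set 'rV[R]_n),
    [/\ H n h, borel_rV B & A = h @^-1` B]].

End linear.

(* E with the point 0, as measurableType requires a pointed type *)
Definition pointed_lmod (R : realType) (E : lmodType R) : Type := E.
HB.instance Definition _ (R : realType) (E : lmodType R) :=
  Choice.on (pointed_lmod E).
HB.instance Definition _ (R : realType) (E : lmodType R) :=
  isPointed.Build (pointed_lmod E) (0 : E).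

Definition vborel (R : realType) (E : lmodType R)
    (H : forall n, set (E -> 'rV[R]_n)) : measurableType _ :=
  g_sigma_algebraType (cylinders H : set (set (pointed_lmod E))).

(* vhom n is the part of the fixed space consisting of maps to R^n. *)
Structure vmspace (R : realType) := VMSpace {
  vsort :> lmodType R;
  vhom : forall n, set (vsort -> 'rV[R]_n);
  vhom_linear : forall n (h : vsort -> 'rV[R]_n), vhom h -> linear h;
  vhom_submod : forall n, subspace_of (@vhom n);
  vhom_sep : forall x, x <> 0 ->
    exists n (h : vsort -> 'rV[R]_n), vhom h /\ h x <> 0;
  vmeasure : probability (vborel (@vhom)) R;
  vlebesgue : lebesgue_rokhlin vmeasure }.

Section vmspace_theory.
Context (R : realType).

Definition free_measure (V : vmspace R) :=
  forall f : vborel (@vhom _ V) -> measurableTypeR R,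
    measurable_fun setT f ->
    exists (L : set V) (g : V -> R^o),
      [/\ subspace_of L, full (vmeasure V) L, linear_on L g &
          eq0 (vmeasure V) f g].

Definition vm_morphism (V W : vmspace R) (f : V -> W) :=
  measure_preserving0 (vmeasure V) (vmeasure W) f /\
  exists L : set V,
    [/\ subspace_of L, full (vmeasure V) L & linear_on L f].

Definition linear_automorphism (V : vmspace R) (f : V -> V) :=
  vm_morphism f /\
  exists g : V -> V,
    [/\ vm_morphism g, eq0 (vmeasure V) (g \o f) id &
        eq0 (vmeasure V) (f \o g) id].

(* W is the linear isomorphic mod 0 image of V; the inverse of f mod 0 need
   not be linear. *)
Definition linear_iso0_image (V W : vmspace R) :=
  exists f : V -> W, vm_morphism f /\ iso0 (vmeasure V) (vmeasure W) f.

Definition measurable_affine_partition (V : vmspace R) (P : set (set V)) :=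
  affine_partition P /\
  exists2 Q, measurable_partition (vmeasure V) Q &
             eq_partition0 (vmeasure V) P Q.

End vmspace_theory.

(* Main.v *)
Require Import Defs.
From HB Require Import structures.
From mathcomp Require Import all_boot all_order all_algebra.
From mathcomp Require Import all_classical all_reals all_analysis.
From mathcomp Require Import measurable_realfun.

Set Implicit Arguments.
Unset Strict Implicit.
Unset Printing Implicit Defensive.

Import Order.TTheory GRing.Theory Num.Theory.
Import numFieldNormedType.Exports.

Local Open Scope classical_set_scope.
Local Open Scope ring_scope.

(** The proof rests on one equivalence: the measure of a vector measure space
    [F] is free if and only if some linearly independent set has full measure.
    If [Y] is such a set, then any function from [Y] to a vector space extends
    to a linear function on the span of [Y], a subspace of full measure
    ([independent_free]). Conversely, the space is coded mod 0 by a real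
    function [f], and freeness makes all its powers linear off one null set;
    then points with distinct codes are independent by a Vandermonde argument
    ([free_independent], [independent_moments]).

    A free measure exists over every Lebesgue-Rokhlin space: put its standard
    model, a measure on the line, on the moment curve [t |-> (t^n)_n] in the
    space of real sequences. The curve is measurable and linearly independent,
    and its first coordinate is an isomorphism mod 0 to the line
    ([lebesgue_rokhlin_curve]). The isomorphism from the curve to a given
    vector measure space then extends linearly. For an arbitrary free
    continuous measure one composes with an isomorphism of atomless spaces
    ([atomless_iso0]) or, when the target has atoms, with an explicit
    measure-preserving step map of the unit interval ([staircase_mp0]).

    Automorphisms are likewise extended linearly from [Y], and so are their
    inverses ([lin_ext_automorphism]). A partition becomes affine through the
    subspace spanned by the differences of points of [Y] lying in the same
    element: independence ensures that the difference of two points of [Y] is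
    in this subspace only if they lie in the same element ([class_spaceP]).

    For the lattice statements, partitions are viewed as equivalence relations
    mod 0 and transported along isomorphisms. The join is the common refinement
    ([join_exists]). The meet is obtained from the separability of the measure
    algebra, which supplies a countable family generating mod 0 the sets that
    are unions of elements of both partitions ([meet_exists]). *)

(** * Linear extension from an independent set *)

Section linear_independence.
Context (R : realType).

Definition lincomb (E : lmodType R) (W : lmodType R) (T : E -> W)
    (s : seq (R * E)) : W :=
  \sum_(p <- s) p.1 *: T p.2.

Local Notation comb := (@lincomb _ _ id).

Definition points_in (E : lmodType R) (Y : set E) (s : seq (R * E)) :=
  forall p, p \in s -> Y p.2.

Definition span_set (E : lmodType R) (Y : set E) : set E :=
  [set x | exists2 s, points_in Y s & x = comb s].

(** The coefficients at one point are summed because a list may repeat it. *)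
Definition independent (E : lmodType R) (Y : set E) :=
  forall s, points_in Y s -> comb s = 0 ->
    forall y, \sum_(p <- s | p.2 == y) p.1 = 0.

Lemma lincomb_cat (E W : lmodType R) (T : E -> W) a s t :
  lincomb T ([seq (a * p.1, p.2) | p <- s] ++ t) =
  a *: lincomb T s + lincomb T t.
Proof.
rewrite /lincomb big_cat big_map /= scaler_sumr; congr (_ + _).
by apply: eq_bigr => p _; rewrite scalerA.
Qed.

Lemma points_in_linear (E : lmodType R) (Y : set E) a s t :
  points_in Y s -> points_in Y t ->
  points_in Y ([seq (a * p.1, p.2) | p <- s] ++ t).
Proof.
move=> Ys Yt p; rewrite mem_cat => /orP[/mapP[q qs ->]/=|]; last exact: Yt.
exact: (Ys q).
Qed.

Lemma subspace_ofP (E : lmodType R) (L : set E) : L 0 ->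
  (forall (a : R) x y, L x -> L y -> L (a *: x + y)) -> subspace_of L.
Proof.
move=> L0 Llin; split=> [|a x y]; rewrite !inE//.
exact: Llin.
Qed.

Lemma subspace_of0 (E : lmodType R) (L : set E) : subspace_of L -> L 0.
Proof. by case; rewrite inE. Qed.

Lemma subspace_of_linear (E : lmodType R) (L : set E) (a : R) x y :
  subspace_of L -> L x -> L y -> L (a *: x + y).
Proof. by case=> _ /(_ a x y); rewrite !inE; exact. Qed.

Lemma span_subspace (E : lmodType R) (Y : set E) : subspace_of (span_set Y).
Proof.
apply: subspace_ofP => [|a x y [s Ys ->] [t Yt ->]].
  by exists [::]; rewrite // /lincomb big_nil.
exists ([seq (a * p.1, p.2) | p <- s] ++ t); first exact: points_in_linear.
by rewrite lincomb_cat.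
Qed.

Lemma sub_span_set (E : lmodType R) (Y : set E) : Y `<=` span_set Y.
Proof.
move=> y Yy; exists [:: (1, y)]; first by move=> p; rewrite inE => /eqP->.
by rewrite /lincomb big_seq1 scale1r.
Qed.

Lemma lincomb_eq0 (E W : lmodType R) (Y : set E) (T : E -> W) s :
  independent Y -> points_in Y s -> comb s = 0 -> lincomb T s = 0.
Proof.
move=> indY Ys /(indY _ Ys) s0.
rewrite /lincomb.
transitivity (\sum_(y <- undup (map snd s))
                \sum_(p <- s | p.2 == y) p.1 *: T y).
  under [RHS]eq_bigr do rewrite big_mkcond/=.
  rewrite exchange_big/=; apply: eq_big_seq => p ps.
  rewrite (bigD1_seq p.2) ?undup_uniq ?mem_undup ?map_f//= eqxx.
  by rewrite big1 ?addr0// => y /negbTE; rewrite eq_sym => ->.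
by apply: big1 => y _; rewrite -scaler_suml s0 scale0r.
Qed.

(** The value at a point of the span is read off from an arbitrarily chosen
    representation; independence makes the choice irrelevant. *)
Definition lin_ext (E W : lmodType R) (Y : set E) (T : E -> W) (x : E) : W :=
  if pselect (span_set Y x) is left h then lincomb T (s2val (cid2 h))
  else 0.

Lemma lin_ext_comb (E W : lmodType R) (Y : set E) (T : E -> W) s :
  independent Y -> points_in Y s -> lin_ext Y T (comb s) = lincomb T s.
Proof.
move=> indY Ys; rewrite /lin_ext; case: pselect => [h|[]]; last by exists s.
case: cid2 => t Yt /= st.
apply/eqP; rewrite -subr_eq0 -[X in _ - X]scale1r -scaleNr addrC.
rewrite -lincomb_cat; apply/eqP; apply: lincomb_eq0 indY _ _ => //.
  exact: points_in_linear.
by rewrite lincomb_cat st scaleN1r addNr.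
Qed.

Lemma lin_ext_id (E W : lmodType R) (Y : set E) (T : E -> W) y :
  independent Y -> Y y -> lin_ext Y T y = T y.
Proof.
move=> indY Yy; have := @lin_ext_comb _ _ Y T [:: (1, y)] indY.
rewrite /lincomb !big_seq1 !scale1r; apply.
by move=> p; rewrite inE => /eqP->.
Qed.

Lemma lin_ext_linear (E W : lmodType R) (Y : set E) (T : E -> W) :
  independent Y -> linear_on (span_set Y) (lin_ext Y T).
Proof.
move=> indY a x y [s Ys ->] [t Yt ->].
rewrite -lincomb_cat !lin_ext_comb// ?lincomb_cat//.
exact: points_in_linear.
Qed.

Lemma linear_on0 (E W : lmodType R) (L : set E) (g : E -> W) :
  subspace_of L -> linear_on L g -> g 0 = 0.
Proof.
move=> sL lg; have L0 := subspace_of0 sL.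
by have := lg (-1) 0 0 L0 L0; rewrite scaler0 addr0 scaleN1r addNr.
Qed.

Lemma lincomb_linear_on (E W : lmodType R) (L : set E) (g : E -> W) s :
  subspace_of L -> linear_on L g -> points_in L s ->
  L (comb s) /\ g (comb s) = lincomb g s.
Proof.
move=> sL lg; elim: s => [|p s IH] Ls.
  rewrite /lincomb !big_nil; split; first exact: subspace_of0.
  exact: linear_on0 lg.
have Lp : L p.2 by apply: Ls; rewrite mem_head.
have [Lc gc] : L (comb s) /\ g (comb s) = lincomb g s.
  by apply: IH => q qs; apply: Ls; rewrite inE qs orbT.
rewrite /lincomb !big_cons; split; first exact: subspace_of_linear.
by rewrite lg// gc.
Qed.

(** Applying the [g n] to a vanishing combination of points [y_i] with
    coefficients [a_i] gives [sum a_i (f y_i)^n = 0] for all [n], hence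
    [sum a_i q(f y_i) = 0] for every polynomial [q]. The polynomial that
    vanishes at all the values [f y_i] but one isolates one coefficient.
    This is used both for the moment curve and for an arbitrary free measure. *)
Lemma independent_moments (E : lmodType R) (Y : set E) (f : E -> R)
    (L : nat -> set E) (g : nat -> E -> R^o) :
  (forall x y, Y x -> Y y -> f x = f y -> x = y) ->
  (forall n, [/\ subspace_of (L n), linear_on (L n) (g n), Y `<=` L n &
                 forall y, Y y -> g n y = f y ^+ n]) ->
  independent Y.
Proof.
move=> finj gf s Ys s0 y.
have mom n : \sum_(p <- s) p.1 * f p.2 ^+ n = 0.
  have [sL lg YL gY] := gf n.
  have Ls : points_in (L n) s by move=> p /Ys /YL.
  have [_] := lincomb_linear_on sL lg Ls; rewrite s0 (linear_on0 sL lg).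
  rewrite /lincomb.
  have gE : forall p, p \in s -> p.1 *: g n p.2 = p.1 *: (f p.2 ^+ n : R^o).
    by move=> p /Ys Yp; rewrite gY.
  rewrite (eq_big_seq _ gE).
  by move=> /esym.
have polmom (q : {poly R}) : \sum_(p <- s) p.1 * q.[f p.2] = 0.
  under eq_bigr do rewrite horner_coef mulr_sumr.
  rewrite exchange_big/= big1// => i _.
  under eq_bigr do rewrite mulrCA.
  by rewrite -mulr_sumr mom mulr0.
have [ys|ys] := boolP (y \in map snd s); last first.
  rewrite big_seq_cond big1// => p /andP[ps /eqP py].
  by move: ys; rewrite -py map_f.
have Yy : Y y by case/mapP: ys => p /Ys Yp ->.
(* [q] vanishes at the values of [f] at all listed points but [y]. *)
pose q := \prod_(z <- map snd s | z != y) ('X - (f z)%:P).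
have qy : q.[f y] != 0.
  rewrite horner_prod prodf_seq_neq0; apply/allP => z zs; apply/implyP => zy.
  have Yz : Y z by case/mapP: zs => p /Ys Yp ->.
  rewrite hornerXsubC subr_eq0; apply: contra zy => /eqP fyz.
  by rewrite (finj _ _ Yz Yy (esym fyz)).
have q0 z : z \in map snd s -> z != y -> q.[f z] = 0.
  move=> zs zy; apply/eqP; rewrite horner_prod prodf_seq_eq0; apply/hasP.
  by exists z; rewrite // zy hornerXsubC subrr eqxx.
have := polmom q; rewrite (bigID (fun p => p.2 == y))/=.
rewrite [X in _ + X]big_seq_cond [X in _ + X]big1 ?addr0; last first.
  by move=> p /andP[ps py]; rewrite q0 ?mulr0 ?map_f.
under eq_bigr => p /eqP -> do [].
rewrite -mulr_suml => /eqP; rewrite mulf_eq0 (negbTE qy) orbF => /eqP.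
exact.
Qed.

(** The subspace spanned by the differences of equivalent points of [Y], cut
    out as the common kernel, in the span of [Y], of the linear extensions of
    the indicators of the classes. *)
Definition class_space (E : lmodType R) (Y : set E) (r : E -> E -> Prop) :
    set E :=
  [set x | span_set Y x /\
     forall z, lin_ext Y (fun y => (`[< r z y >]%:R : R^o)) x = 0].

Lemma class_space_subspace (E : lmodType R) (Y : set E) r :
  independent Y -> subspace_of (class_space Y r).
Proof.
move=> indY; apply: subspace_ofP => [|a x y [Yx x0] [Yy y0]].
  split=> [|z]; first by apply: subspace_of0; exact: span_subspace.
  have := @lin_ext_comb _ _ Y (fun y => (`[< r z y >]%:R : R^o)) [::] indY.
  by rewrite /lincomb !big_nil; apply.
split=> [|z]; first by apply: subspace_of_linear => //; exact: span_subspace.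
by rewrite lin_ext_linear// x0 y0 scaler0 addr0.
Qed.

(** For [x] and [y] in [Y], the value at [y - x] of the extended indicator of
    a class is the difference of its values at [y] and [x]. *)
Lemma class_spaceP (E : lmodType R) (Y : set E) (r : E -> E -> Prop) x y :
  independent Y -> (forall x, r x x) -> (forall x y, r x y -> r y x) ->
  (forall x y z, r x y -> r y z -> r x z) ->
  Y x -> Y y -> class_space Y r (y - x) <-> r x y.
Proof.
move=> indY rr rs rt Yx Yy.
have Sx := sub_span_set Yx; have Sy := sub_span_set Yy.
have eB z : lin_ext Y (fun y => (`[< r z y >]%:R : R^o)) (y - x) =
    `[< r z y >]%:R - `[< r z x >]%:R.
  by rewrite -scaleN1r addrC lin_ext_linear// !lin_ext_id// scaleN1r addrC.
split=> [[_ /(_ x)]|rxy].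
  rewrite eB (asboolT (rr x)); case: asboolP => // _ /eqP.
  by rewrite sub0r oppr_eq0 oner_eq0.
split=> [|z].
  rewrite -scaleN1r addrC; apply: subspace_of_linear => //.
  exact: span_subspace.
rewrite eB; apply/eqP; rewrite subr_eq0; apply/eqP; congr (_ %:R).
congr nat_of_bool; apply: asbool_equiv_eq; split=> h.
  by apply: rt h _; exact: rs.
exact: rt h rxy.
Qed.

Lemma cosetsP (E : lmodType R) (L : set E) x y : subspace_of L ->
  (exists2 C, cosets L C & C x /\ C y) <-> L (y - x).
Proof.
move=> sL; have LB u v : L u -> L v -> L (v - u).
  by move=> Lu Lv; rewrite -scaleN1r addrC; exact: subspace_of_linear.
split=> [[C [z ->]] [/= zx zy]|Lxy].
  by have := LB _ _ zx zy; rewrite opprB addrA subrK.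
exists [set u | L (u - x)]; first by exists x.
by split=> //=; rewrite subrr; exact: subspace_of0.
Qed.

End linear_independence.

(** * Sets and maps modulo null sets *)

Section null_sets.
Context (R : realType) d (T : measurableType d) (mu : probability T R).

Lemma symdiff_subP (U : Type) (A B N : set U) :
  A `+` B `<=` N <-> (forall x, ~ N x -> (A x <-> B x)).
Proof.
split=> [sN x Nx|sN x].
  split=> [Ax|Bx]; apply: contrapT => h; apply: Nx; apply: sN; [left|right];
    by split.
by case=> -[Ax Bx]; apply: contrapT => /sN h; apply: Bx; apply/h.
Qed.

Lemma fullT : full mu setT.
Proof. by rewrite /full setCT; exact: negligible_set0. Qed.

Lemma fullS A B : A `<=` B -> full mu A -> full mu B.
Proof. by move=> AB; apply: negligibleS => x; apply: contra_not; exact: AB. Qed.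

Lemma fullI A B : full mu A -> full mu B -> full mu (A `&` B).
Proof. by rewrite /full setCI; exact: negligibleU. Qed.

Lemma full_forall (A : nat -> set T) :
  (forall n, full mu (A n)) -> full mu [set x | forall n, A n x].
Proof.
move=> fA; have := negligible_bigcup fA; apply: negligibleS => x /= h.
by have /existsNP[n An] := h; exists n.
Qed.

Lemma negligible_symdiffP A B :
  mu.-negligible (A `+` B) <-> full mu [set x | A x <-> B x].
Proof.
split; apply: negligibleS => x /=.
  by move=> h; apply: contrapT => h'; apply: h; move: x h';
    exact/(symdiff_subP A B (A `+` B)).
by move=> ABx h; have /symdiff_subP := @subset_refl _ (A `+` B);
  move: ABx => [[Ax Bx] _|[Bx Ax] _]; [apply: Bx; apply/h|apply: Ax; apply/h].
Qed.

Lemma measurable0_measurable A : measurable A -> Defs.measurable0 mu A.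
Proof.
move=> mA; exists A => //; apply/negligible_symdiffP.
by apply: fullS fullT => x _.
Qed.

Lemma eq_measure0 A B : measurable A -> measurable B ->
  full mu [set x | A x <-> B x] -> mu A = mu B.
Proof.
suff le C D : measurable C -> measurable D ->
    full mu [set x | C x <-> D x] -> (mu C <= mu D)%E.
  move=> mA mB h; apply/eqP; rewrite eq_le !le// .
  by apply: fullS h => x /= ->.
move=> mC mD [N [mN N0 sN]].
rewrite (@le_trans _ _ (mu (D `|` N)))//.
  rewrite le_measure ?inE//; first exact: measurableU.
  move=> x Cx; have [Nx|Nx] := pselect (N x); [by right|left].
  have /(_ Cx) : C x -> D x; last by [].
  by apply: contrapT => h; apply: Nx; apply: sN => -[].
apply: (le_trans (measureU2 _ mD mN)).
by rewrite [X in (_ + X <= _)%E](N0 : _ = 0%E) adde0.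
Qed.

End null_sets.

Section measure_preserving.
Context (R : realType).

Section two_spaces.
Context d1 (T1 : measurableType d1) (mu1 : probability T1 R)
  d2 (T2 : measurableType d2) (mu2 : probability T2 R).

(** The same condition with the symmetric difference replaced by a pointwise
    equivalence on a set of full measure, which is the form in which it
    composes. *)
Lemma measure_preserving0P (f : T1 -> T2) :
  measure_preserving0 mu1 mu2 f <->
  forall B, measurable B -> exists A,
    [/\ measurable A, full mu1 [set x | B (f x) <-> A x] & mu1 A = mu2 B].
Proof.
by split=> h B /h[A [mA AB AE]]; exists A; split=> //;
  exact/(negligible_symdiffP mu1 (f @^-1` B) A).
Qed.

Lemma mp0_negligible (f : T1 -> T2) N : measure_preserving0 mu1 mu2 f ->
  mu2.-negligible N -> mu1.-negligible (f @^-1` N).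
Proof.
move=> /measure_preserving0P mpf [M [mM M0 NM]].
have [A [mA AB AE]] := mpf _ mM.
have A0 : mu1.-negligible A by exists A; split=> //; rewrite AE.
apply: negligibleS (negligibleU A0 AB) => x /= /NM Mx.
have [Ax|Ax] := pselect (A x); [by left|right].
by case=> /(_ Mx).
Qed.

Lemma mp0_full (f : T1 -> T2) Y : measure_preserving0 mu1 mu2 f ->
  full mu2 Y -> full mu1 (f @^-1` Y).
Proof. by move=> mpf fY; exact: (mp0_negligible mpf fY). Qed.

Lemma mp0_measurable0 (f : T1 -> T2) B : measure_preserving0 mu1 mu2 f ->
  Defs.measurable0 mu2 B -> Defs.measurable0 mu1 (f @^-1` B).
Proof.
move=> mpf [C mC /negligible_symdiffP BC].
have [A [mA AC _]] := (measure_preserving0P f).1 mpf _ mC.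
exists A => //; apply/negligible_symdiffP.
by apply: fullS (fullI (mp0_full mpf BC) AC) => x /= [-> ->].
Qed.

Lemma mp0_eq0 (f g : T1 -> T2) : measure_preserving0 mu1 mu2 f ->
  eq0 mu1 f g -> measure_preserving0 mu1 mu2 g.
Proof.
move=> /measure_preserving0P mpf fg; apply/measure_preserving0P => B mB.
have [A [mA AB AE]] := mpf _ mB.
by exists A; split=> //; apply: fullS (fullI fg AB) => x /= [->].
Qed.

Lemma eq0_sym (U : Type) (f g : T1 -> U) : eq0 mu1 f g -> eq0 mu1 g f.
Proof. by apply: (@fullS _ _ _ mu1) => x /= ->. Qed.

Lemma eq0_trans (U : Type) (f g h : T1 -> U) :
  eq0 mu1 f g -> eq0 mu1 g h -> eq0 mu1 f h.
Proof.
by move=> fg gh; apply: (@fullS _ _ _ mu1 _ _ _ (fullI fg gh)) => x /= [-> ->].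
Qed.

Lemma eq0_comp (U : Type) (f : T1 -> T2) (g h : T2 -> U) :
  measure_preserving0 mu1 mu2 f -> eq0 mu2 g h -> eq0 mu1 (g \o f) (h \o f).
Proof. by move=> mpf gh; exact: (mp0_full mpf gh). Qed.

Lemma eq0_post (U W : Type) (f g : T1 -> U) (h : U -> W) :
  eq0 mu1 f g -> eq0 mu1 (h \o f) (h \o g).
Proof. by apply: (@fullS _ _ _ mu1) => x /= ->. Qed.

Lemma iso0_sym (f : T1 -> T2) : iso0 mu1 mu2 f ->
  exists g : T2 -> T1, [/\ iso0 mu2 mu1 g, eq0 mu1 (g \o f) id &
                           eq0 mu2 (f \o g) id].
Proof.
by case=> mf [g [mg gf fg]]; exists g; split=> //; split=> //; exists f.
Qed.

Lemma eq_measurable_mp0 (f : T1 -> T2) : measurable_fun setT f ->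
  (forall B, measurable B -> mu1 (f @^-1` B) = mu2 B) ->
  measure_preserving0 mu1 mu2 f.
Proof.
move=> mf fE; apply/measure_preserving0P => B mB; exists (f @^-1` B).
split; last exact: fE; last exact: (fullS _ (fullT mu1)).
by rewrite -[X in measurable X]setTI; exact: mf.
Qed.

End two_spaces.

Section three_spaces.
Context d1 (T1 : measurableType d1) (mu1 : probability T1 R)
  d2 (T2 : measurableType d2) (mu2 : probability T2 R)
  d3 (T3 : measurableType d3) (mu3 : probability T3 R).

Lemma mp0_comp (f : T1 -> T2) (g : T2 -> T3) :
  measure_preserving0 mu1 mu2 f -> measure_preserving0 mu2 mu3 g ->
  measure_preserving0 mu1 mu3 (g \o f).
Proof.
move=> mpf /measure_preserving0P mpg; apply/measure_preserving0P => C mC.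
have [B [mB BC BE]] := mpg _ mC.
have [A [mA AB AE]] := (measure_preserving0P _ _ f).1 mpf _ mB.
exists A; split=> //; last by rewrite AE.
by apply: fullS (fullI (mp0_full mpf BC) AB) => x /= [-> ->].
Qed.

End three_spaces.

Section iso0_composition.
Context d1 (T1 : measurableType d1) (mu1 : probability T1 R)
  d2 (T2 : measurableType d2) (mu2 : probability T2 R)
  d3 (T3 : measurableType d3) (mu3 : probability T3 R).

Lemma iso0_comp (f : T1 -> T2) (g : T2 -> T3) :
  iso0 mu1 mu2 f -> iso0 mu2 mu3 g -> iso0 mu1 mu3 (g \o f).
Proof.
move=> [mf [f' [mf' f'f ff']]] [mg [g' [mg' g'g gg']]].
split; first exact: mp0_comp mf mg.
exists (f' \o g'); split; first exact: mp0_comp mg' mf'.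
  apply: eq0_trans f'f; apply: (eq0_post f').
  exact: (eq0_comp mf g'g).
apply: eq0_trans gg'; apply: (eq0_post g).
exact: (eq0_comp mg' ff').
Qed.

End iso0_composition.

Section iso0_mod0.
Context d1 (T1 : measurableType d1) (mu1 : probability T1 R)
  d2 (T2 : measurableType d2) (mu2 : probability T2 R).

Lemma iso0_eq0 (f g : T1 -> T2) :
  iso0 mu1 mu2 f -> eq0 mu1 f g -> iso0 mu1 mu2 g.
Proof.
move=> [mf [h [mh hf fh]]] fg; split; first exact: mp0_eq0 mf fg.
exists h; split=> //.
  by apply: eq0_trans hf; apply: (eq0_post h); exact: eq0_sym.
by apply: eq0_trans fh; exact: (eq0_comp mh (eq0_sym fg)).
Qed.

(** A subset of a measurable copy of [f @^-1` A] is carried by the inverse to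
    a subset of [A] of the same measure. *)
Lemma iso0_atomless (f : T1 -> T2) :
  iso0 mu1 mu2 f -> atomless mu1 -> atomless mu2.
Proof.
move=> [mf [g [mg gf fg]]] at1 [A [mA A0 Aat]]; apply: at1.
have [A' [mA' AA' EA']] := (measure_preserving0P _ _ f).1 mf _ mA.
exists A'; split; rewrite ?EA'// => B mB BA'.
have [B' [mB' BB' EB']] := (measure_preserving0P _ _ g).1 mg _ mB.
have B'A : full mu2 [set y | B' y <-> (B' `&` A) y].
  have h := fullI (mp0_full mg AA') (fullI BB' fg).
  apply: fullS h => y /= [gA [gB fgy]]; split=> [|[]//]; split=> //.
  by rewrite -fgy; apply/gA/BA'/gB.
have := Aat _ (measurableI _ _ mB' mA) (@subIsetr _ _ _).
by rewrite -(eq_measure0 _ _ B'A) ?EB'//; exact: measurableI.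
Qed.

End iso0_mod0.

(** The preimages of the countably many rational rays are measurable outside
    one common null set; the function is changed there only. *)
Lemma mp0_measurable_version d (T : measurableType d) (mu : probability T R)
    (Q : probability (measurableTypeR R) R) (f : T -> measurableTypeR R) :
  measure_preserving0 mu Q f ->
  exists2 g : T -> measurableTypeR R, measurable_fun setT g & eq0 mu f g.
Proof.
move=> /measure_preserving0P mpf.
pose ray (n : nat) : set (measurableTypeR R) :=
  if unpickle n is Some q then `]ratr (q : rat), +oo[%classic else set0.
have mray n : measurable (ray n).
  by rewrite /ray; case: unpickle => [q|//]; exact: measurable_itv.
have /choice[A /all_and3[mA AE _]] := fun n => mpf _ (mray n).
have [N [mN N0 sN]] := full_forall AE.
pose g x := if pselect (N x) is left _ then 0 else f x : measurableTypeR R.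
exists g; last first.
  exists N; split=> // x /= gx; apply: contrapT => Nx; apply: gx.
  by rewrite /g; case: pselect.
have gray n : measurable (g @^-1` (ray n)).
  have -> : g @^-1` (ray n) = (N `&` [set x | ray n 0]) `|` (A n `\` N).
    apply/seteqP; split=> x /=; rewrite /g; case: pselect => Nx /=.
    - by move=> ?; left.
    - move=> fx; right; split=> //.
      have /(_ n)[+ _] : forall n, ray n (f x) <-> A n x.
        by apply: contrapT => h; apply: Nx; exact: sN.
      exact.
    - by case=> [[]|[]].
    - case=> [[]//|[Ax _]].
      have /(_ n)[_] : forall n, ray n (f x) <-> A n x.
        by apply: contrapT => h; apply: Nx; exact: sN.
      exact.
  apply: measurableU; last exact: measurableD.
  have [h|h] := pselect (ray n 0).
    by rewrite (_ : [set x | _] = setT) ?setIT//; apply/seteqP; split.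
  by rewrite (_ : [set x | _] = set0) ?setI0//; apply/seteqP; split.
apply: (measurability _ (RGenOInfty.measurableE R)) => _ [_ [a ->] <-].
rewrite setTI.
have -> : g @^-1` `]a, +oo[ = \bigcup_n
    (g @^-1` (if a < (if unpickle n is Some q then ratr (q : rat) else a)
              then ray n else set0)).
  apply/seteqP; split=> x /=; rewrite ?in_itv/= ?andbT.
    move=> /rat_in_itvoo[q]; rewrite in_itv/= => /andP[aq qg].
    exists (pickle q) => //=; rewrite /ray pickleK aq /=.
    by rewrite in_itv/= andbT.
  move=> [n _ /=]; case: ifPn => // + ; rewrite /ray; case: unpickle => // q aq.
  by rewrite /= in_itv/= andbT; exact: lt_trans.
apply: bigcupT_measurable => n; case: ifPn => // _.
by rewrite preimage_set0.
Qed.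

End measure_preserving.

(** * A free measure on the moment curve *)

Section moment_curve.
Context (R : realType).

Definition sequences : lmodType R := (nat -> R^o : lmodType R).

Definition moment_curve (t : R) : sequences := fun n => t ^+ n.

(** Continuity along the curve makes the curve a measurable map for the
    generated sigma-algebra, and still leaves room for all the coordinates. *)
Definition curve_hom n : set (sequences -> 'rV[R]_n) :=
  [set h | linear h /\ continuous (h \o moment_curve : R -> 'rV[R]_n)].

Definition curve_space := vborel curve_hom.

Lemma curve_hom_linear n (h : sequences -> 'rV[R]_n) : curve_hom h -> linear h.
Proof. by case. Qed.

Lemma curve_hom_submod n : subspace_of (@curve_hom n).
Proof.
apply: subspace_ofP => [|a f g [lf cf] [lg cg]].
  split=> [a x y|]; first by rewrite /= scaler0 addr0.
  exact: cst_continuous.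
split=> [b x y|t].
  rewrite /= !fctE lf lg !scalerDr !scalerA mulrC.
  by rewrite addrACA.
apply: (@cvgD _ 'rV[R]_n _ _ _
  (fun t => a *: f (moment_curve t)) (fun t => g (moment_curve t))).
  by apply: cvgZl_tmp; exact: cf.
exact: cg.
Qed.

Definition coordinate n (x : sequences) : 'rV[R]_1 := \row_(_ < 1) x n.

Lemma coordinate_hom n : curve_hom (coordinate n).
Proof.
split=> [a x y|t]; first by apply/rowP => i; rewrite !mxE.
have -> : coordinate n \o moment_curve =
    fun t => (t ^+ n) *: (const_mx 1 : 'rV[R]_1).
  by apply/funext => u; apply/rowP => i; rewrite !mxE mulr1.
by apply: cvgZr_tmp; exact: exprn_continuous.
Qed.

Lemma curve_hom_sep (x : sequences) : x <> 0 ->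
  exists n (h : sequences -> 'rV[R]_n), curve_hom h /\ h x <> 0.
Proof.
move=> x0; suff [n xn] : exists n, x n <> 0.
  exists 1%N, (coordinate n); split; first exact: coordinate_hom.
  by move=> /rowP /(_ ord0); rewrite !mxE.
by apply/existsNP => h; apply: x0; apply/funext.
Qed.

Lemma measurable_curve :
  measurable_fun setT (moment_curve : measurableTypeR R -> curve_space).
Proof.
apply: measurability; first by [].
move=> _ [_ [n [h [B [[lh ch] bB ->]]]] <-]; rewrite setTI.
have : <<s open >> `<=` [set B : set 'rV[R]_n |
    measurable (((h \o moment_curve) : measurableTypeR R -> _) @^-1` B)].
  apply: smallest_sub.
    split=> [|A /= mA|F /= mF].
    - by rewrite /= preimage_set0.
    - by rewrite setTD preimage_setC; exact: measurableC.
    - by rewrite preimage_bigcup; exact: bigcupT_measurable.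
  move=> A oA /=; apply: open_measurable; move/continuousP: ch; exact.
by move=> /(_ _ bB).
Qed.

Lemma measurable_coord n :
  measurable_fun setT (fun x : curve_space => x n : measurableTypeR R).
Proof.
apply: (measurability _ (RGenOInfty.measurableE R)) => _ [_ [a ->] <-].
rewrite setTI; apply: sub_sigma_algebra.
exists 1%N, (coordinate n), [set v | a < v ord0 ord0]; split.
- exact: coordinate_hom.
- apply: sub_sigma_algebra.
  have := @coord_continuous R 1 1 ord0 ord0.
  move/continuousP => /(_ [set u | a < u]).
  by apply; exact: open_gt.
- by apply/seteqP; split=> x /=; rewrite in_itv/= andbT !mxE.
Qed.

Definition curve_set : set sequences := range moment_curve.

(** The curve is cut out by countably many equations between coordinates,
    which makes it a measurable set. *)
Lemma curve_setE : curve_set = [set x | forall n, x n = x 1%N ^+ n].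
Proof.
apply/seteqP; split=> [_ [t _ <-] n|x xE]; first by rewrite /moment_curve expr1.
by exists (x 1%N) => //; apply/funext => n; rewrite xE.
Qed.

Lemma measurable_curve_set : measurable (curve_set : set curve_space).
Proof.
rewrite curve_setE.
have -> : [set x : curve_space | forall n, x n = x 1%N ^+ n :> R] =
    \bigcap_n ((fun x : curve_space =>
                  x n - x 1%N ^+ n : measurableTypeR R) @^-1` [set 0]).
  apply/seteqP; split=> [x xE n _|x xE n]; first by rewrite /= xE subrr.
  by apply/eqP; rewrite -subr_eq0; apply/eqP; exact: xE.
apply: bigcapT_measurable => n.
rewrite -[X in measurable X]setTI.
apply: measurable_funB => //; first exact: measurable_coord.
by apply: measurable_funX; exact: measurable_coord.
Qed.

Lemma curve_set_independent : independent curve_set.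
Proof.
rewrite curve_setE.
apply: (@independent_moments _ sequences _ (fun x => x 1%N) (fun=> setT)
  (fun n x => x n)) => [x y xE yE xy|n].
  by apply/funext => n; rewrite xE yE xy.
by split=> //; split=> [|a x y _ _]; rewrite inE.
Qed.

Section curve_measure.
Variable Q : probability (measurableTypeR R) R.

HB.instance Definition _ := isMeasurableFun.Build _ _ _ _
  (moment_curve : measurableTypeR R -> curve_space) measurable_curve.

Definition curve_measure : probability curve_space R :=
  distribution Q (moment_curve : measurableTypeR R -> curve_space).

Lemma full_curve_set : full curve_measure curve_set.
Proof.
exists (~` curve_set); split=> //.
  by apply: measurableC; exact: measurable_curve_set.
have N0 : (moment_curve : measurableTypeR R -> curve_space) @^-1`
    (~` curve_set) = set0.
  by rewrite -subset0 => t /=; apply; exists t.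
suff : Q set0 = 0%E by rewrite -N0.
exact: measure0.
Qed.

Lemma curve_iso0 :
  iso0 curve_measure Q (fun x : curve_space => x 1%N : measurableTypeR R).
Proof.
split.
  apply: eq_measurable_mp0 => [|B mB]; first exact: measurable_coord.
  suff -> : B = moment_curve @^-1` ((fun x : curve_space => x 1%N : R) @^-1` B).
    by [].
  by apply/seteqP; split=> x; rewrite /= /moment_curve expr1.
exists moment_curve; split.
- by apply: eq_measurable_mp0 => [|B mB]; first exact: measurable_curve.
- by apply: fullS full_curve_set => _ [t _ <-] /=; rewrite /moment_curve expr1.
- by apply: fullS (fullT _) => t _ /=; rewrite /moment_curve expr1.
Qed.
End curve_measure.

End moment_curve.

(** * Free measures and independent sets of full measure *)

Section free_measures.
Context (R : realType).

(** The heart of the matter. Let [f] code the points by reals, injectively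
    mod 0. By freeness each of the countably many powers [f^n] is linear on a
    subspace of full measure, up to a null set; outside the union of these
    null sets the moments of [f] are therefore given by linear functionals. *)
Lemma free_independent (F : vmspace R) : free_measure F ->
  exists2 Y : set F, full (vmeasure F) Y & independent Y.
Proof.
move=> freeF; have [Q [c [w [_ _ _ [f isof]]]]] := vlebesgue F.
have [mpf [f' [_ f'f _]]] := isof.
have [g mg fg] := mp0_measurable_version mpf.
have /choice[L /choice[l lP]] : forall n, exists (L : set F) (l : F -> R^o),
    [/\ subspace_of L, full (vmeasure F) L, linear_on L l &
        eq0 (vmeasure F) (fun x => g x ^+ n) l].
  move=> n; apply: freeF; exact: measurable_funX.
have fL : full (vmeasure F) [set x | forall n, L n x].
  by apply: full_forall => n; have [] := lP n.
have fl : full (vmeasure F) [set x | forall n, g x ^+ n = l n x].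
  by apply: full_forall => n; have [] := lP n.
pose Y : set F := [set x | (f' (f x) = x /\ f x = g x) /\
  (forall n, L n x) /\ (forall n, g x ^+ n = l n x)].
exists Y.
  by apply: fullS (fullI (fullI f'f fg) (fullI fL fl)) => x.
apply: (@independent_moments _ _ _ f L l).
  by move=> x y [[xE _] _] [[yE _] _] fxy; rewrite -xE fxy yE.
move=> n; have [sL _ lL _] := lP n.
split=> // y [[_ fgy] [Ly ly]]; first exact: Ly.
by rewrite -ly fgy.
Qed.

Lemma full_span (F : vmspace R) (Y : set F) :
  full (vmeasure F) Y -> full (vmeasure F) (span_set Y).
Proof. by apply: fullS; exact: (@sub_span_set _ F). Qed.

(** Any function on an independent set extends linearly to the span. *)
Lemma independent_free (F : vmspace R) (Y : set F) :
  full (vmeasure F) Y -> independent Y -> free_measure F.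
Proof.
move=> fY indY f _; exists (span_set Y), (lin_ext Y (f : F -> R^o)); split.
- exact: span_subspace.
- exact: full_span.
- exact: lin_ext_linear.
- by apply: fullS fY => y Yy /=; rewrite lin_ext_id.
Qed.

Section linearization.
Variables (F W : vmspace R) (Y : set F).
Hypotheses (fY : full (vmeasure F) Y) (indY : independent Y).

Lemma lin_ext_eq0 (T : F -> W) : eq0 (vmeasure F) T (lin_ext Y T).
Proof. by apply: fullS fY => y Yy /=; rewrite lin_ext_id. Qed.

Lemma lin_ext_morphism (T : F -> W) :
  measure_preserving0 (vmeasure F) (vmeasure W) T ->
  vm_morphism (lin_ext Y T).
Proof.
move=> mT; split; first exact: mp0_eq0 mT (lin_ext_eq0 T).
exists (span_set Y); split; first exact: span_subspace.
  exact: full_span.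
exact: lin_ext_linear.
Qed.

Lemma lin_ext_iso0_image (T : F -> W) :
  iso0 (vmeasure F) (vmeasure W) T -> linear_iso0_image F W.
Proof.
move=> iT; exists (lin_ext Y T); split.
  by apply: lin_ext_morphism; case: iT.
exact: iso0_eq0 iT (lin_ext_eq0 T).
Qed.

End linearization.

(** The extensions of a map and of its inverse are inverse to each other only
    mod 0, because they agree with the given maps only on [Y]. *)
Lemma lin_ext_automorphism (F : vmspace R) (Y : set F) (T : F -> F) :
  full (vmeasure F) Y -> independent Y -> automorphism0 (vmeasure F) T ->
  linear_automorphism (lin_ext Y T).
Proof.
move=> fY indY [mT [S [mS ST TS]]].
have eT := lin_ext_eq0 fY indY T; have eS := lin_ext_eq0 fY indY S.
split; first exact: lin_ext_morphism.
exists (lin_ext Y S); split; first exact: lin_ext_morphism.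
  apply: eq0_trans ST; apply: eq0_trans (eq0_sym (eq0_comp mT eS)).
  exact: eq0_post (eq0_sym eT).
apply: eq0_trans TS; apply: eq0_trans (eq0_sym (eq0_comp mS eT)).
exact: eq0_post (eq0_sym eS).
Qed.

End free_measures.

(** * The standard models of Lebesgue-Rokhlin spaces *)

Section standard_model.
Context (R : realType).

Definition standard_form (Q : probability (measurableTypeR R) R) c
    (w : nat -> R) :=
  [/\ 0 <= c, (forall n, 0 <= w n) &
      forall B : set (measurableTypeR R), measurable B ->
        Q B = (lebesgue_measure (B `&` [set t | 0 <= t <= c]%R) +
               \sum_(0 <= n <oo) (w n)%:E * \d_(n.+2%:R : R) B)%E].

Lemma curve_lebesgue Q c w : standard_form Q c w ->
  lebesgue_rokhlin (curve_measure Q).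
Proof.
move=> [c0 w0 QE]; exists Q, c, w; split=> //.
by eexists; exact: curve_iso0.
Qed.

Definition curve_vmspace Q c w (h : standard_form Q c w) : vmspace R :=
  VMSpace (@curve_hom_linear R) (@curve_hom_submod R) (@curve_hom_sep R)
    (curve_lebesgue h).

Lemma curve_free Q c w (h : standard_form Q c w) :
  free_measure (curve_vmspace h).
Proof.
apply: (@independent_free _ (curve_vmspace h) (@curve_set R)).
  exact: full_curve_set.
exact: curve_set_independent.
Qed.

(** Placing the standard model of [mu] on the moment curve. *)
Lemma lebesgue_rokhlin_curve d (T : measurableType d) (mu : probability T R) :
  lebesgue_rokhlin mu -> exists (F : vmspace R) (f : F -> T),
    free_measure F /\ iso0 (vmeasure F) mu f.
Proof.
move=> [Q [c [w [c0 w0 QE [f isof]]]]].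
have h : standard_form Q c w by split.
have [g [isog _ _]] := iso0_sym isof.
exists (curve_vmspace h),
  (g \o (fun x : curve_space R => x 1%N : measurableTypeR R)).
split; first exact: curve_free.
exact: iso0_comp (curve_iso0 Q) isog.
Qed.

End standard_model.

Section uniform.
Context (R : realType).
Local Notation leb := (@lebesgue_measure R).
Local Notation T := (measurableTypeR R).

Definition unit_interval : set T := [set t : R | 0 <= t <= 1].

Lemma segmentE (c : R) : [set t : R | 0 <= t <= c] = `[0, c]%classic.
Proof. by apply/seteqP; split=> t /=; rewrite in_itv. Qed.

Lemma measurable_segment (c : R) :
  measurable ([set t : R | 0 <= t <= c] : set T).
Proof. by rewrite segmentE; exact: measurable_itv. Qed.

Lemma lebesgue_segment (c : R) : 0 <= c -> leb [set t : R | 0 <= t <= c] = c%:E.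
Proof.
rewrite segmentE lebesgue_measure_itv /= lte_fin le_eqVlt => /orP[/eqP <-|->].
  by rewrite ltxx.
by rewrite oppr0 adde0.
Qed.

Let m := mrestr leb (measurable_segment 1).

Let m_setT : m setT = 1%E.
Proof. by rewrite /m /mrestr setTI lebesgue_segment. Qed.

HB.instance Definition _ := Measure.on m.
HB.instance Definition _ := Measure_isProbability.Build _ _ _ m m_setT.

Definition unit_measure : probability T R := m.

Lemma unit_measureE (B : set T) : unit_measure B = leb (B `&` unit_interval).
Proof. by []. Qed.

Lemma unit_standard : standard_form unit_measure 1 (fun=> 0).
Proof.
split=> // B mB; rewrite unit_measureE eseries0 ?adde0// => n _ _.
by rewrite mul0e.
Qed.

(** An atom would meet each interval of length half its measure in a null
    set, and countably many such intervals cover it. *)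
Lemma unit_atomless : atomless unit_measure.
Proof.
move=> [A [mA A0 Aat]].
have Afin : unit_measure A \is a fin_num by exact: fin_num_measure.
pose a := fine (unit_measure A).
have aE : unit_measure A = a%:E by rewrite fineK.
have a0 : 0 < a by rewrite -lte_fin -aE.
pose e := a / 2.
have e0 : 0 < e by rewrite divr_gt0.
pose I k : set T := `[k%:R * e, k.+1%:R * e]%classic.
have Inull k : unit_measure.-negligible (A `&` I k).
  have mI : measurable (A `&` I k).
    by apply: measurableI => //; exact: measurable_itv.
  apply/negligibleP => //; have [//|AI] := Aat _ mI (@subIsetl _ _ _).
  exfalso; suff : (unit_measure (A `&` I k) < unit_measure A)%E.
    by rewrite AI ltxx.
  apply: (@le_lt_trans _ _ (leb (I k))).
    rewrite unit_measureE le_measure ?inE//.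
    - by apply: measurableI => //; exact: measurable_segment.
    - exact: measurable_itv.
    - by move=> t [[]].
  rewrite lebesgue_measure_itv /= lte_fin ltr_pM2r// ltr_nat leqnn -EFinD aE.
  rewrite lte_fin -mulrBl -natrB// subSnn mul1r /e.
  by rewrite ltr_pdivrMr// ltr_pMr// ltr1n.
have [N [mN N0 sN]] := negligible_bigcup Inull.
suff : unit_measure A = 0%E by move=> h; rewrite h ltxx in A0.
apply/negligibleP => //; exists (N `|` ~` unit_interval); split.
- by apply: measurableU => //; apply: measurableC; exact: measurable_segment.
- change (unit_measure (N `|` ~` unit_interval) = 0%E).
  by rewrite unit_measureE setIUl setICl setU0; exact: N0.
- move=> t At; have [ti|] := pselect (unit_interval t); [left|by right].
  apply: sN; have /andP[t0 _] := ti.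
  have te : 0 <= t / e by rewrite divr_ge0// ltW.
  exists (Num.truncn (t / e)) => //; split=> //; rewrite /I /=.
  have /andP[h1 h2] := truncn_itv te.
  by rewrite in_itv/= -ler_pdivlMr// h1/= -ler_pdivrMr// ltW.
Qed.

Lemma standard_total (Q : probability T R) c w : standard_form Q c w ->
  (c%:E + \sum_(0 <= n <oo) (w n)%:E = 1%E)%E.
Proof.
move=> [c0 w0 QE]; rewrite -(probability_setT Q) QE// setTI lebesgue_segment//.
by congr (_ + _)%E; apply: eq_eseriesr => n _; rewrite diracT mule1.
Qed.

Lemma standard_atomless (Q : probability T R) c w :
  standard_form Q c w -> atomless Q -> forall n, w n = 0.
Proof.
move=> [c0 w0 QE] at0 n; apply/eqP; rewrite eq_le w0 andbT leNgt.
apply/negP => wn; apply: at0; exists [set n.+2%:R]; split.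
- exact: measurable_set1.
- rewrite QE//; apply: (@lt_le_trans _ _ (w n)%:E); rewrite ?lte_fin//.
  rewrite -[leLHS]add0e; apply: leeD => //.
  apply: le_trans (nneseries_lim_ge n.+1 _); last first.
    by move=> k _ _; rewrite mule_ge0 ?lee_fin.
  rewrite big_nat_recr//= diracE mem_set// mule1 leeDr// sume_ge0// => k _.
  by rewrite mule_ge0 ?lee_fin.
- by move=> B _ /subset_set1[->|->]; [left|right].
Qed.

(** Without atoms all the point masses of the standard model vanish, and the
    total mass forces the interval to have length 1. *)
Lemma atomless_iso0_unit d (X : measurableType d) (mu : probability X R) :
  lebesgue_rokhlin mu -> atomless mu ->
  exists f : X -> T, iso0 mu unit_measure f.
Proof.
move=> [Q [c [w [c0 w0 QE [f isof]]]]] amu.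
have h : standard_form Q c w by split.
have wE := standard_atomless h (iso0_atomless isof amu).
have c1 : c = 1.
  have := standard_total h; rewrite eseries0 ?adde0 => [[]//|n _ _].
  by rewrite wE.
have QU B : measurable B -> Q B = unit_measure B.
  move=> mB; rewrite QE// eseries0 ?adde0 ?c1// => n _ _.
  by rewrite wE mul0e.
exists f; apply: (iso0_comp isof (g := idfun)); split.
  by apply: eq_measurable_mp0 => [|B mB]; [exact: measurable_id|]; exact: QU.
exists id; split; last 2 first.
- exact: fullS (fullT Q).
- exact: fullS (fullT unit_measure).
apply: eq_measurable_mp0 => [|B mB]; first exact: measurable_id.
by apply: esym; exact: QU.
Qed.

(** A measure-preserving map from the unit interval onto a standard model: the
    identity on [0, c], and the value [n + 2] on an interval of length [w n],
    these intervals following each other from [c] on. *)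
Section staircase.
Variables (Q : probability T R) (c : R) (w : nat -> R).
Hypothesis h : standard_form Q c w.

Let step n : R := c + \sum_(0 <= i < n) w i.
Let I n : set T := `]step n, step n.+1]%classic.

Let c0 : 0 <= c. Proof. by case: h. Qed.
Let w0 n : 0 <= w n. Proof. by case: h => _ + _; exact. Qed.

Let step_nd k n : (k <= n)%N -> step k <= step n.
Proof.
move=> kn; rewrite /step lerD2l (big_cat_nat _ kn)//= lerDl.
by apply: sumr_ge0.
Qed.

Let step0 : step 0 = c.
Proof. by rewrite /step big_geq// addr0. Qed.

Let step_le1 n : step n <= 1.
Proof.
rewrite -lee_fin -(standard_total h) /step EFinD leeD2l// -sumEFin.
by apply: nneseries_lim_ge => k _ _; rewrite lee_fin.
Qed.

Let step_cover t : c < t -> t < 1 -> exists n, I n t.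
Proof.
move=> ct t1; have [n tn] : exists n, t <= step n.
  apply: contrapT => /forallNP nt.
  suff : (1%:E <= t%:E :> \bar R)%E by rewrite lee_fin leNgt t1.
  rewrite -(standard_total h) addeC -leeBrDr//.
  apply: lime_le; first by apply: is_cvg_nneseries => k _ _; rewrite lee_fin.
  apply: nearW => n; rewrite sumEFin -EFinD lee_fin lerBrDl.
  by have /negP := nt n; rewrite -ltNge => /ltW.
case: (ex_minnP (ex_intro (fun n => t <= step n) n tn)) => -[|k] tk kmin.
  by move: tk; rewrite step0 leNgt ct.
exists k; rewrite /I /= in_itv/= tk andbT ltNge; apply/negP => /kmin.
by rewrite ltnn.
Qed.

Let I_inj t k n : I k t -> I n t -> k = n.
Proof.
wlog kn : k n / (k <= n)%N.
  move=> wl Ik In; have [kn|/ltnW nk] := leqP k n; first exact: wl.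
  by apply/esym; exact: wl.
rewrite /I /= !in_itv/= => /andP[_ tk] /andP[nt _].
move: kn; rewrite leq_eqVlt => /orP[/eqP//|/step_nd kn].
by have := lt_le_trans nt (le_trans tk kn); rewrite ltxx.
Qed.

Definition staircase (t : R) : T :=
  if t <= c then t else (xget 0%N [set n | I n t]).+2%:R.

Lemma staircase_mp0 : measure_preserving0 unit_measure Q staircase.
Proof.
apply/measure_preserving0P => B mB.
pose J n : set T := if n.+2%:R \in B then I n else set0.
have mJ n : measurable (J n).
  by rewrite /J; case: ifP => // _; exact: measurable_itv.
have JI n : J n `<=` I n by rewrite /J; case: ifP => _ t.
have Ic n t : I n t -> c < t.
  rewrite /I /= in_itv/= => /andP[nt _]; apply: le_lt_trans nt.
  by rewrite -step0; exact: step_nd.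
have mBc : measurable (B `&` [set t | 0 <= t <= c]).
  by apply: measurableI => //; exact: measurable_segment.
have mUJ : measurable (\bigcup_n J n) by exact: bigcupT_measurable.
(* Within the unit interval this is the preimage of [B], except possibly at
   the point 1, which no step need cover. *)
exists ((B `&` [set t | 0 <= t <= c]) `|` \bigcup_n J n); split.
- exact: measurableU.
- exists ([set t | 1 <= t] `|` ~` unit_interval); split.
  + apply: measurableU; last by apply: measurableC; exact: measurable_segment.
    rewrite (_ : mkset _ = `[1, +oo[%classic); first exact: measurable_itv.
    by apply/seteqP; split=> t /=; rewrite in_itv/= andbT.
  + change (unit_measure ([set t | 1 <= t] `|` ~` unit_interval) = 0%E).
    rewrite unit_measureE setIUl setICl setU0.
    rewrite (_ : _ `&` _ = [set 1]) ?lebesgue_measure_set1//.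
    apply/seteqP; split=> t /=; last first.
      by move=> ->; rewrite /unit_interval /= lexx ler01.
    by move=> [t1 /andP[_ t1']]; apply/le_anti; rewrite t1 t1'.
  + move=> t; apply: contra_notP => /not_orP[/negP + /contrapT /andP[t0 _]].
    rewrite -ltNge => t1 /=; rewrite /staircase; case: ifPn => tc.
      split=> [Bt|[[]//|[n _ /JI/Ic]]]; last by rewrite ltNge tc.
      by left; split=> //=; rewrite t0.
    move: tc; rewrite -ltNge => tc; have [n In] := step_cover tc t1.
    have -> : xget 0%N [set k | I k t] = n.
      case: xgetP => [k _ /= Ik|/(_ n)//]; exact: I_inj Ik In.
    split=> [Bn|[[_ /andP[_ //]]|[k _ Jk]]].
    * by right; exists n => //; rewrite /J mem_set.
    * have kn := I_inj (JI _ _ Jk) In; move: Jk; rewrite kn /J.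
      by case: ifPn => // /set_mem.
- have [_ _ ->//] := h.
  rewrite unit_measureE setIidl; last first.
    move=> t [[_ /andP[t0 tc]]|[n _ /JI]].
      by rewrite /unit_interval /= t0 (le_trans tc)// -step0 step_le1.
    move=> In; have ct := Ic _ _ In.
    move: In; rewrite /I /= in_itv/= => /andP[_ tn].
    rewrite /unit_interval /= (le_trans tn (step_le1 _)) andbT.
    by rewrite (le_trans c0)// ltW.
  rewrite measureU//; last first.
    apply/seteqP; split=> // t [[_ /andP[_ tc]] [n _ /JI/Ic]].
    by rewrite ltNge tc.
  congr (_ + _)%E.
  rewrite [LHS](@measure_bigcup _ _ _ leb)//=; last first.
    move=> i j _ _ [t [Ji Jj]]; exact: I_inj (JI _ _ Ji) (JI _ _ Jj).
  under eq_eseriesl do rewrite in_setT.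
  apply: eq_eseriesr => n _.
  rewrite /J diracE; case: ifPn => _; last by rewrite measure0 mule0.
  rewrite mule1 lebesgue_measure_itv /= lte_fin /step big_nat_recr//= addrA.
  rewrite ltrDl; case: ltP => wn.
    by rewrite -EFinD [X in X%:E = _]addrC addKr.
  by congr (_%:E); apply/eqP; rewrite eq_le wn w0.
Qed.

End staircase.

End uniform.

(** * Separability of the measure algebra *)

Section closeness.
Context (R : realType).

Section one_space.
Context d (T : measurableType d) (mu : probability T R).
Implicit Types (A B C : set T) (e : R).

(** A bound on the outer measure of the symmetric difference, which makes
    sense for arbitrary sets. *)
Definition close0 e A B := exists N,
  [/\ measurable N, (mu N < e%:E)%E & forall x, ~ N x -> (A x <-> B x)].

Lemma close0_full e A B :
  0 < e -> full mu [set x | A x <-> B x] -> close0 e A B.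
Proof.
move=> e0 [N [mN N0 sN]]; exists N; split=> //; first by rewrite N0 lte_fin.
by move=> x Nx; apply: contrapT => h; apply: Nx; exact: sN.
Qed.

Lemma close0_sym e A B : close0 e A B -> close0 e B A.
Proof. by case=> N [mN Ne AB]; exists N; split=> // x /AB[]. Qed.

Lemma close0_merge (A B A' B' A'' B'' : set T) e e' :
  close0 e A B -> close0 e' A' B' ->
  (forall x, (A x <-> B x) -> (A' x <-> B' x) -> (A'' x <-> B'' x)) ->
  close0 (e + e') A'' B''.
Proof.
move=> [N [mN Ne AB]] [N' [mN' Ne' AB']] h; exists (N `|` N'); split.
- exact: measurableU.
- by apply: (le_lt_trans (measureU2 _ mN mN')); rewrite EFinD lteD.
- by move=> x /not_orP[/AB ? /AB' ?]; exact: h.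
Qed.

Lemma close0_trans B A C e e' :
  close0 e A B -> close0 e' B C -> close0 (e + e') A C.
Proof. by move=> AB BC; apply: close0_merge AB BC _ => x -> ->. Qed.

Lemma close0_le e e' A B : e <= e' -> close0 e A B -> close0 e' A B.
Proof.
move=> ee' [N [mN Ne AB]]; exists N; split=> //.
by apply: (lt_le_trans Ne); rewrite lee_fin.
Qed.

Lemma close0_C e A B : close0 e A B -> close0 e (~` A) (~` B).
Proof.
by move=> [N [mN Ne AB]]; exists N; split=> // x /AB h; rewrite /setC/= h.
Qed.

(** The dense sequence may consist of arbitrary sets: they only serve as
    centres of balls. *)
Definition separable0 := exists D : nat -> set T,
  forall A e, Defs.measurable0 mu A -> 0 < e -> exists n, close0 e A (D n).

End one_space.

Lemma close0_preimage d1 (T1 : measurableType d1) (mu1 : probability T1 R)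
    d2 (T2 : measurableType d2) (mu2 : probability T2 R) (f : T1 -> T2) e A B :
  measure_preserving0 mu1 mu2 f -> close0 mu2 e A B ->
  close0 mu1 e (f @^-1` A) (f @^-1` B).
Proof.
move=> mf [N [mN Ne AB]].
have [M [mM [Z [mZ Z0 sZ]] ME]] := (measure_preserving0P _ _ f).1 mf _ mN.
exists (M `|` Z); split; first exact: measurableU.
  apply: (le_lt_trans (measureU2 _ mM mZ)).
  by rewrite [X in (_ + X < _)%E](Z0 : _ = 0%E) adde0 -ME in Ne *.
move=> x /not_orP[Mx Zx]; apply: AB => Nfx; apply: Mx.
have : N (f x) <-> M x by apply: contrapT => h; apply: Zx; exact: sZ.
by case=> h _; exact: h.
Qed.

Section real_line.
Variable Q : probability (measurableTypeR R) R.

(** A countable Boolean algebra generated by rational rays: a node of a tree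
    is the NOR of its children, and this single connective expresses complement
    and union. Trees are used because they form a countable type. *)
Fixpoint ray_formula (t : GenTree.tree rat) : set (measurableTypeR R) :=
  match t with
  | GenTree.Leaf q => `]ratr q, +oo[%classic
  | GenTree.Node _ ts => ~` foldr (fun t A => ray_formula t `|` A) set0 ts
  end.

(** The approximable measurable sets form a sigma-algebra: a countable union
    is approximated by finite ones, by continuity of the measure. *)
Lemma ray_formula_dense A e : measurable A -> 0 < e ->
  exists t, close0 Q e A (ray_formula t).
Proof.
pose S : set (set (measurableTypeR R)) := [set A | measurable A /\
  forall e, 0 < e -> exists t, close0 Q e A (ray_formula t)].
have SC A' : S A' -> S (~` A').
  move=> [mA hA]; split=> [|e' e0]; first exact: measurableC.
  have [t At] := hA _ e0; exists (GenTree.Node 0 [:: t]).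
  by rewrite /= setU0; exact: close0_C.
have S0 : S set0.
  split=> // e' e0; exists (GenTree.Node 0 [:: GenTree.Node 0 [::]]).
  apply: close0_full => //; apply: fullS (fullT Q) => x _ /=.
  by split=> // h; apply: h; left.
have SU A1 A2 : S A1 -> S A2 -> S (A1 `|` A2).
  move=> [m1 h1] [m2 h2]; split=> [|e' e0]; first exact: measurableU.
  have e2 : 0 < e' / 2 by rewrite divr_gt0.
  have [t1 c1] := h1 _ e2; have [t2 c2] := h2 _ e2.
  exists (GenTree.Node 0 [:: GenTree.Node 0 [:: t1; t2]]).
  rewrite [e']splitr /= !setU0 setCK; apply: close0_merge c1 c2 _ => x h1' h2'.
  by rewrite /setU /= h1' h2'.
have Sbig (F : nat -> set (measurableTypeR R)) :
    (forall n, S (F n)) -> S (\bigcup_n F n).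
  move=> SF; have mF n : measurable (F n) by case: (SF n).
  have mU : measurable (\bigcup_n F n) by exact: bigcupT_measurable.
  split=> // e' e0; have e2 : 0 < e' / 2 by rewrite divr_gt0.
  pose G k := \big[setU/set0]_(i < k) F i.
  have SG k : S (G k).
    by rewrite /G; elim/big_ind : _ => // i _; exact: SF.
  have mG k : measurable (G k) by case: (SG k).
  have [k Hk] : exists k, (Q (\bigcup_n F n `\` G k) < (e' / 2)%:E)%E.
    have hcvg : Q (\bigcup_n F n `\` G k) @[k --> \oo] -->
        Q (\bigcap_k (\bigcup_n F n `\` G k)).
      apply: nonincreasing_cvg_mu.
      - rewrite (le_lt_trans (probability_le1 _ _)) ?ltry//.
        exact: measurableD.
      - by move=> i; exact: measurableD.
      - by apply: bigcapT_measurable => i; exact: measurableD.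
      - move=> i j ij; apply/subsetPset; apply: setDS.
        exact: subset_bigsetU.
    have C0 : \bigcap_k (\bigcup_n F n `\` G k) = set0.
      rewrite -subset0 => x /= h; have [[n _ Fnx] _] := h 0%N Logic.I.
      have [_] := h n.+1 Logic.I; apply.
      by rewrite /G big_ord_recr/=; right.
    rewrite C0 measure0 in hcvg.
    have /hcvg : nbhs (0%E : \bar R) [set y | (y < (e' / 2)%:E)%E].
      apply: open_nbhs_nbhs; split; first exact: open_ereal_lt_ereal.
      by rewrite /= lte_fin.
    by case=> k _ /(_ k (leqnn k)) /= ?; exists k.
  have [t ct] := (SG k).2 _ e2; exists t; rewrite [e']splitr.
  apply: close0_trans ct; exists (\bigcup_n F n `\` G k); split=> //.
    exact: measurableD.
  move=> x h; split=> [Fx|]; first by apply: contrapT => Gx; exact: h.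
  by rewrite /G -bigcup_mkord => -[i _ Fi]; exists i.
move=> mA e0; suff : S A by case=> _ /(_ _ e0).
rewrite RGenOInfty.measurableE in mA.
move: A mA; apply: smallest_sub.
  by split=> // A SA; rewrite setTD; exact: SC.
move=> _ [a ->].
have -> : `]a, +oo[%classic = \bigcup_n
    (if unpickle n is Some q then
       if a < ratr (q : rat) then `]ratr q, +oo[%classic else set0
     else set0) :> set R.
  apply/seteqP; split=> x /=; rewrite ?in_itv/= ?andbT.
    move=> /rat_in_itvoo[q]; rewrite in_itv/= => /andP[aq qx].
    by exists (pickle q); [by []|rewrite pickleK aq /= in_itv/= andbT].
  move=> [n _ /=]; case: unpickle => // q; case: ifPn => // aq.
  by rewrite /= !in_itv/= !andbT; exact: lt_trans.
apply: Sbig => n; case: unpickle => [q|//]; case: ifPn => // _.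
split=> [|e' e0']; first exact: measurable_itv.
exists (GenTree.Leaf q); apply: close0_full => //.
exact: fullS (fullT Q).
Qed.

End real_line.
End closeness.

Section separability.
Context (R : realType) d (T : measurableType d) (mu : probability T R).

(** A measurable set is, up to a null set, the preimage of a Borel set of the line. *)
Lemma lebesgue_rokhlin_separable : lebesgue_rokhlin mu -> separable0 mu.
Proof.
move=> [Q [_ [_ [_ _ _ [f [mf [g [mg gf _]]]]]]]].
exists (fun n => if unpickle n is Some t then f @^-1` ray_formula t else set0).
move=> A e mA e0; have [B mB /negligible_symdiffP AB] := mp0_measurable0 mg mA.
have e2 : 0 < e / 2 by rewrite divr_gt0.
have [t Bt] := ray_formula_dense Q mB e2.
exists (pickle t); rewrite pickleK [e]splitr.
apply: close0_trans (close0_preimage mf Bt); apply: close0_full => //.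
by apply: fullS (fullI gf (mp0_full mf AB)) => x /= [gfx <-]; rewrite gfx.
Qed.

(** [E] is dense in [M] for the distance of closeness, since subsets of
    separable spaces are separable. Each [A] in [M] is then the limit of some
    [E (n k)] at summable distances, and by Borel-Cantelli almost every point
    lies in [A] iff it lies in [E (n k)] for all large [k]. *)
Lemma separating_subfamily (M : set (set T)) : separable0 mu -> M set0 ->
  (forall A, M A -> Defs.measurable0 mu A) ->
  exists E : nat -> set T, (forall n, M (E n)) /\
    forall A, M A -> exists2 Y, full mu Y & forall x y, Y x -> Y y ->
      (forall n, E n x <-> E n y) -> (A x <-> A y).
Proof.
move=> [D Ddense] M0 mM.
(* [E] picks a member of [M] within 1/(m+1) of [D k] whenever there is one,
   for each pair (k, m). *)
have /choice[E EP] : forall i, exists A, M A /\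
    (forall k m, unpickle i = Some (k, m) ->
     (exists2 B, M B & close0 mu (m.+1%:R^-1) B (D k)) ->
     close0 mu (m.+1%:R^-1) A (D k)).
  move=> i; case E : (unpickle i) => [[k m]|]; last by exists set0.
  have [[B MB BD]|h] := pselect
    (exists2 B, M B & close0 mu (m.+1%:R^-1) B (D k)).
    by exists B; split=> // _ _ [<- <-].
  by exists set0; split=> // _ _ [<- <-] /h.
exists E; split=> [n|A MA]; first by case: (EP n).
have dense e : 0 < e -> exists n, close0 mu e A (E n).
  move=> e0; have e2 : 0 < e / 2 by rewrite divr_gt0.
  have [m me] : exists m : nat, m.+1%:R^-1 <= e / 2.
    have ei : 0 <= (e / 2)^-1 by rewrite invr_ge0 ltW.
    exists (Num.truncn (e / 2)^-1).
    rewrite -[leRHS]invrK lef_pV2 ?posrE ?invr_gt0//.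
    by apply: ltW; have /andP[_] := truncn_itv ei.
  have m0 : 0 < m.+1%:R^-1 :> R by rewrite invr_gt0.
  have [k Ak] := Ddense A _ (mM _ MA) m0.
  exists (pickle (k, m)).
  have [_ /(_ k m)] := EP (pickle (k, m)); rewrite pickleK => /(_ erefl) h.
  have Ek : close0 mu (m.+1%:R^-1) (E (pickle (k, m))) (D k).
    by apply: h; exists A.
  rewrite [e]splitr; apply: close0_trans (close0_le me (close0_sym Ek)).
  exact: close0_le me Ak.
have eps k : 0 < 1 / (2 ^ k.+1)%:R :> R by rewrite divr_gt0// ltr0n expn_gt0.
have /choice[n /choice[N /all_and3[mN Ne AE]]] := fun k => dense _ (eps k).
exists (~` lim_sup_set N).
  rewrite /full setCK; exists (lim_sup_set N); split=> //.
    apply: bigcapT_measurable => j; exact: bigcup_measurable.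
  apply: lim_sup_set_cvg0 => //.
  apply: (@le_lt_trans _ _ (\sum_(k <oo) (1 / (2 ^ k.+1)%:R)%:E)%E).
    by apply: lee_nneseries => // k _; exact/ltW/Ne.
  by rewrite (le_lt_trans (epsilon_trick0 _ _))// ltry.
move=> x y /existsNP[i /not_implyP[_ xi]] /existsNP[j /not_implyP[_ yj]] Exy.
have xN : ~ N (maxn i j) x.
  by move=> h; apply: xi; exists (maxn i j) => //=; exact: leq_maxl.
have yN : ~ N (maxn i j) y.
  by move=> h; apply: yj; exists (maxn i j) => //=; exact: leq_maxr.
by rewrite (AE _ _ xN) (AE _ _ yN).
Qed.

End separability.

(** * The lattice of measurable partitions *)

Section partitions.
Context (R : realType).

(** [refines0 mu P Q] is [implies0 mu (same_element P) (same_element Q)] by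
    definition; arbitrary relations allow pulling back along maps. *)
Definition implies0 d (T : measurableType d) (mu : probability T R)
    (r s : T -> T -> Prop) :=
  exists2 Y, full mu Y & forall x y, Y x -> Y y -> r x y -> s x y.

Definition separated_by (U : Type) (B : nat -> set U) (x y : U) :=
  forall n, B n x <-> B n y.

Definition fibers (U : Type) (B : nat -> set U) : set (set U) :=
  range (separated_by B).

Section one_space.
Context d (T : measurableType d) (mu : probability T R).
Implicit Types (r s : T -> T -> Prop) (P Q : set (set T)).

Lemma implies0W r s : (forall x y, r x y -> s x y) -> implies0 mu r s.
Proof. by move=> rs; exists setT; [exact: fullT|move=> x y _ _; exact: rs]. Qed.

Lemma implies0_trans r s t :
  implies0 mu r s -> implies0 mu s t -> implies0 mu r t.
Proof.
move=> [Y fY rs] [Z fZ st]; exists (Y `&` Z); first exact: fullI.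
by move=> x y [Yx Zx] [Yy Zy] /rs rxy; apply: st => //; exact: rxy.
Qed.

Lemma implies0_forall r (s : nat -> T -> T -> Prop) :
  (forall n, implies0 mu r (s n)) ->
  implies0 mu r (fun x y => forall n, s n x y).
Proof.
move=> h.
have /choice[Y YP] : forall n, exists Y, full mu Y /\
    forall x y, Y x -> Y y -> r x y -> s n x y.
  by move=> n; have [Y fY Yrs] := h n; exists Y.
exists [set x | forall n, Y n x].
  by apply: full_forall => n; case: (YP n).
by move=> x y Yx Yy rxy n; apply: (YP n).2.
Qed.

Lemma same_element_fibers (B : nat -> set T) (x y : T) :
  same_element (fibers B) x y <-> separated_by B x y.
Proof.
split=> [[_ [z _ <-] [zx zy]] n|xy]; first by rewrite -zx -zy.
by exists (separated_by B x); [exists x|].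
Qed.

Lemma measurable_fibers (B : nat -> set T) :
  (forall n, Defs.measurable0 mu (B n)) ->
  measurable_partition mu (fibers B).
Proof.
move=> mB; split.
  split.
  - apply/seteqP; split=> // x _; exists (separated_by B x) => //.
    by exists x.
  - move=> _ _ [x _ <-] [y _ <-] [z [xz yz]]; apply/funext => u; apply/propext.
    by split=> h n; [rewrite yz -xz|rewrite xz -yz].
  - by move=> _ [x _ <-]; exists x.
exists B; split=> //.
  move=> n _ [x _ <-]; have [Bx|Bx] := pselect (B n x); [left|right] => y xy.
    exact/xy.
  by move=> /xy.
move=> _ _ [x _ <-] [y _ <-] xy.
have [n Bxy] : exists n, ~ (B n x <-> B n y).
  apply/existsNP => h; apply: xy; apply/funext => u; apply/propext.
  by split=> hu n; rewrite -hu; [apply: iff_sym|]; exact: h.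
exists n; have [Bx|Bx] := pselect (B n x); [left|right]; split=> u xu.
- exact/xu.
- by move=> /xu By; apply: Bxy.
- by apply/xu; apply: contrapT => By; apply: Bxy.
- by move=> /xu.
Qed.

(** The separating sets are exact unions of elements, so that they describe
    the elements everywhere and not only mod 0. From here on a measurable
    partition is handled through such a sequence. *)
Lemma measurable_partitionP P : measurable_partition mu P ->
  exists2 B, (forall n, Defs.measurable0 mu (B n)) &
    forall x y, same_element P x y <-> separated_by B x y.
Proof.
move=> [[covP trivP _] [B [mB sat sep]]]; exists B => // x y; split.
  move=> [C PC [Cx Cy]] n; have [CB|CB] := sat n C PC.
    by split=> _; exact: CB.
  by split=> h; exfalso; [exact: (CB x)|exact: (CB y)].
have : cover P id x by rewrite covP.
have : cover P id y by rewrite covP.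
move=> [D PD Dy] [C PC Cx] xy; exists C => //; split=> //.
have [->//|/(sep _ _ PC PD)[n [[CB DB]|[DB CB]]]] := pselect (C = D).
  by exfalso; apply: (DB y Dy); apply/xy; exact: CB.
by exfalso; apply: (CB x Cx); apply/xy; exact: DB.
Qed.

Lemma same_element_equiv P : measurable_partition mu P ->
  [/\ forall x, same_element P x x,
      forall x y, same_element P x y -> same_element P y x &
      forall x y z, same_element P x y -> same_element P y z ->
        same_element P x z].
Proof.
move=> /measurable_partitionP[B _ PB].
split=> [x|x y /PB xy|x y z /PB xy /PB yz]; apply/PB => n //.
  by rewrite xy.
by rewrite xy yz.
Qed.

Section lattice.
Variables P Q : set (set T).
Hypotheses (mP : measurable_partition mu P) (mQ : measurable_partition mu Q).

(** The common refinement is separated by the two separating sequences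
    together. *)
Lemma join_exists : exists2 J, is_join0 mu (measurable_partition mu) P Q J &
  forall x y, same_element P x y -> same_element Q x y -> same_element J x y.
Proof.
have [B mB PB] := measurable_partitionP mP.
have [C mC QC] := measurable_partitionP mQ.
pose D n := if odd n then B n./2 else C n./2.
have DP x y : separated_by D x y <-> (same_element P x y /\ same_element Q x y).
  rewrite PB QC; split=> [xy|[Bxy Cxy] n]; last by rewrite /D; case: odd.
  split=> n.
    by have := xy n.*2.+1; rewrite /D /= odd_double /= uphalf_double.
  by have := xy n.*2; rewrite /D odd_double doubleK.
exists (fibers D); last by move=> x y xP xQ; apply/same_element_fibers/DP.
split.
- by apply: measurable_fibers => n; rewrite /D; case: odd.
- by apply: implies0W => x y /same_element_fibers/DP[].
- by apply: implies0W => x y /same_element_fibers/DP[].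
- move=> J' _ [Y fY JP] [Z fZ JQ]; exists (Y `&` Z); first exact: fullI.
  move=> x y [Yx Zx] [Yy Zy] xy; apply/same_element_fibers/DP.
  by split; [exact: JP|exact: JQ].
Qed.

(** The meet is the partition separated by a countable dense subfamily of the
    measurable sets that are mod 0 unions of elements of [P] and also mod 0
    unions of elements of [Q]. A coarser measurable partition is separated by
    sets of this family, and these are determined mod 0 by the subfamily. *)
Lemma meet_exists : separable0 mu ->
  exists M, is_meet0 mu (measurable_partition mu) P Q M.
Proof.
move=> sepmu.
pose M A := [/\ Defs.measurable0 mu A,
  implies0 mu (same_element P) (fun x y => A x <-> A y) &
  implies0 mu (same_element Q) (fun x y => A x <-> A y)].
have [||E [ME Esep]] := separating_subfamily (M := M) sepmu.
- split; [|exact: implies0W|exact: implies0W].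
  exact: measurable0_measurable.
- by move=> A [].
exists (fibers E); split.
- by apply: measurable_fibers => n; case: (ME n).
- apply: implies0_trans (_ : implies0 mu _ (separated_by E)) _.
    by apply: implies0_forall => n; case: (ME n).
  by apply: implies0W => x y /same_element_fibers.
- apply: implies0_trans (_ : implies0 mu _ (separated_by E)) _.
    by apply: implies0_forall => n; case: (ME n).
  by apply: implies0W => x y /same_element_fibers.
- move=> M' mM' PM' QM'; have [B mB MB] := measurable_partitionP mM'.
  apply: implies0_trans (_ : implies0 mu _ (separated_by B)) _.
    apply: implies0_forall => n.
    have [|Y fY EB] := Esep (B n).
      split=> //.
        by apply: implies0_trans PM' _; apply: implies0W => x y /MB.
      by apply: implies0_trans QM' _; apply: implies0W => x y /MB.
    by exists Y => // x y Yx Yy /same_element_fibers; exact: EB.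
  by apply: implies0W => x y /MB.
Qed.

End lattice.

(** Any join agrees mod 0 with the common refinement. *)
Lemma join_same_element P Q J : measurable_partition mu P ->
  measurable_partition mu Q -> is_join0 mu (measurable_partition mu) P Q J ->
  implies0 mu (fun x y => same_element P x y /\ same_element Q x y)
    (same_element J).
Proof.
move=> mP mQ [_ _ _ Jmin]; have [J0 [mJ0 J0P J0Q _] J0max] := join_exists mP mQ.
apply: implies0_trans (Jmin _ mJ0 J0P J0Q).
by apply: implies0W => x y [xP xQ]; exact: J0max.
Qed.

End one_space.

Lemma implies0_preimage d1 (T1 : measurableType d1) (mu1 : probability T1 R)
    d2 (T2 : measurableType d2) (mu2 : probability T2 R) (f : T1 -> T2) r s :
  measure_preserving0 mu1 mu2 f -> implies0 mu2 r s ->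
  implies0 mu1 (fun x y => r (f x) (f y)) (fun x y => s (f x) (f y)).
Proof.
move=> mf [Y fY rs]; exists (f @^-1` Y); first exact: mp0_full mf fY.
by move=> x y; exact: rs.
Qed.

Lemma implies0_eq0 d (T : measurableType d) (mu : probability T R) (U : Type)
    (f g : T -> U) (r : U -> U -> Prop) : eq0 mu f g ->
  implies0 mu (fun x y => r (f x) (f y)) (fun x y => r (g x) (g y)).
Proof. by move=> fg; exists [set x | f x = g x] => // x y /= -> ->. Qed.

End partitions.

(** * Universality, automorphisms and partitions *)

Lemma atomless_iso0 (R : realType) d1 (T1 : measurableType d1)
    (mu1 : probability T1 R) d2 (T2 : measurableType d2)
    (mu2 : probability T2 R) :
  lebesgue_rokhlin mu1 -> atomless mu1 ->
  lebesgue_rokhlin mu2 -> atomless mu2 -> exists f : T1 -> T2, iso0 mu1 mu2 f.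
Proof.
move=> L1 a1 L2 a2; have [f isof] := atomless_iso0_unit L1 a1.
have [g isog] := atomless_iso0_unit L2 a2.
have [g' [isog' _ _]] := iso0_sym isog.
by exists (g' \o f); exact: iso0_comp isof isog'.
Qed.

Lemma same_element_class_space (R : realType) (F : vmspace R) (Y : set F)
    (r : F -> F -> Prop) (x y : F) :
  independent Y -> (forall x, r x x) -> (forall x y, r x y -> r y x) ->
  (forall x y z, r x y -> r y z -> r x z) -> Y x -> Y y ->
  @same_element _ (vborel (@vhom _ F)) (cosets (class_space Y r)) x y <-> r x y.
Proof.
move=> indY rr rs rt Yx Yy.
apply: (iff_trans (cosetsP x y (class_space_subspace r indY))).
exact: class_spaceP.
Qed.

Lemma curve_morphism (R : realType) (F V : vmspace R) :
  free_measure F -> atomless (vmeasure F) -> exists f : F -> V, vm_morphism f.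
Proof.
move=> freeF atF; have [Y fY indY] := free_independent freeF.
have [Q [c [w [c0 w0 QE [v isov]]]]] := vlebesgue V.
have h : standard_form Q c w by split.
have [v' [[mv' _] _ _]] := iso0_sym isov.
have [u [mu _]] := atomless_iso0_unit (vlebesgue F) atF.
exists (lin_ext Y (v' \o (staircase c w \o u) : F -> V)).
refine (lin_ext_morphism fY indY _).
exact: mp0_comp (mp0_comp mu (staircase_mp0 h)) mv'.
Qed.

(** Transfer along an isomorphism mod 0 [f], with inverse [g], onto a space
    with an independent set [Y] of full measure. *)
Section transfer.
Context (R : realType) d (X : measurableType d) (mu : probability X R).
Variables (F : vmspace R) (Y : set F).
Hypotheses (fY : full (vmeasure F) Y) (indY : independent Y).
Local Notation nu := (vmeasure F).
Variables (f : X -> vborel (@vhom _ F)) (g : vborel (@vhom _ F) -> X).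
Hypotheses (mf : measure_preserving0 mu nu f)
  (mg : measure_preserving0 nu mu g) (gf : eq0 mu (g \o f) id)
  (fg : eq0 nu (f \o g) id).

(** Conjugate by [f] and extend linearly from [Y]. *)
Lemma linear_automorphism_transfer : exists Phi : (X -> X) -> (F -> F),
  [/\ forall S, automorphism0 mu S -> linear_automorphism (Phi S),
      forall S T, automorphism0 mu S -> automorphism0 mu T ->
        eq0 nu (Phi (S \o T)) (Phi S \o Phi T) &
      forall S T, automorphism0 mu S -> automorphism0 mu T ->
        (eq0 mu S T <-> eq0 nu (Phi S) (Phi T))].
Proof.
have isof : iso0 mu nu f by split=> //; exists g.
have isog : iso0 nu mu g by split=> //; exists f.
pose conj (S : X -> X) : F -> F := f \o (S \o g).
have conjP S : eq0 nu (conj S) (lin_ext Y (conj S)) by exact: lin_ext_eq0.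
exists (fun S => lin_ext Y (conj S)); split=> [S aS|S T aS aT|S T aS aT].
- apply: lin_ext_automorphism fY indY _.
  exact: iso0_comp (iso0_comp isog aS) isof.
- apply: eq0_trans (eq0_sym (conjP _)) _.
  have mT : measure_preserving0 nu nu (conj T).
    exact: mp0_comp (mp0_comp mg aT.1) mf.
  apply: eq0_trans (_ : eq0 nu _ (conj S \o conj T)) _.
    apply: (eq0_post (f \o S)).
    exact: (eq0_comp (mp0_comp mg aT.1) (eq0_sym gf)).
  apply: eq0_trans (eq0_comp mT (conjP S)) _.
  exact: eq0_post (conjP T).
- split=> [ST|PST].
    apply: eq0_trans (eq0_sym (conjP _)) _; apply: eq0_trans (conjP T).
    by apply: eq0_post; exact: (eq0_comp mg ST).
  have CST : eq0 nu (conj S) (conj T).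
    by apply: eq0_trans (conjP S) _; apply: eq0_trans PST (eq0_sym (conjP T)).
  have back U : measure_preserving0 mu mu U -> eq0 mu (g \o (conj U \o f)) U.
    move=> mU; apply: eq0_trans (eq0_comp mf (eq0_comp (mp0_comp mg mU) gf)) _.
    exact: (eq0_post U gf).
  apply: eq0_trans (eq0_sym (back S aS.1)) _.
  apply: eq0_trans (back T aT.1); apply: eq0_post.
  exact: (eq0_comp mf CST).
Qed.

Definition affine_model (P : set (set X)) : set (set F) :=
  cosets (class_space Y (fun x y => same_element P (g x) (g y))).

Local Notation same_model P :=
  (@same_element _ (vborel (@vhom _ F)) (affine_model P)).

Lemma affine_modelP P : measurable_partition mu P ->
  exists2 Z : set F, full nu Z & forall x y, Z x -> Z y ->
    same_model P x y <->
    same_element P (g x) (g y).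
Proof.
move=> /same_element_equiv[rP sP tP]; exists Y => // x y Yx Yy.
apply: (@same_element_class_space _ F) => //.
- by move=> z u; exact: sP.
- by move=> z u v; exact: tP.
Qed.

Lemma affine_model_affine P : affine_partition (affine_model P).
Proof.
exists (class_space Y (fun x y => same_element P (g x) (g y))) => //.
exact: class_space_subspace.
Qed.

Let to_model P : measurable_partition mu P ->
  implies0 nu (fun x y => same_element P (g x) (g y))
    (same_model P).
Proof.
by move=> /affine_modelP[Z fZ h]; exists Z => // x y Zx Zy /h; apply.
Qed.

Let of_model P : measurable_partition mu P ->
  implies0 nu (same_model P)
    (fun x y => same_element P (g x) (g y)).
Proof.
by move=> /affine_modelP[Z fZ h]; exists Z => // x y Zx Zy /h; apply.
Qed.

Lemma affine_model_measurable P : measurable_partition mu P ->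
  measurable_affine_partition (affine_model P).
Proof.
move=> mP; split; first exact: affine_model_affine.
have [B mB PB] := measurable_partitionP mP.
exists (fibers (fun n => g @^-1` B n)).
  by apply: measurable_fibers => n; exact: mp0_measurable0 mg (mB n).
have [Z fZ h] := affine_modelP mP; exists Z => // x y Zx Zy.
apply: iff_trans (h x y Zx Zy) _; apply: iff_trans (PB _ _) _.
by apply: iff_sym; exact: same_element_fibers.
Qed.

Lemma refines0_affine_model P Q :
  measurable_partition mu P -> measurable_partition mu Q ->
  refines0 mu P Q <-> refines0 nu (affine_model P) (affine_model Q).
Proof.
move=> mP mQ; split=> PQ.
  apply: implies0_trans (of_model mP) _.
  exact: implies0_trans (implies0_preimage mg PQ) (to_model mQ).
have PQg := implies0_trans (to_model mP) (implies0_trans PQ (of_model mQ)).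
apply: implies0_trans (implies0_eq0 (same_element P) (eq0_sym gf)) _.
exact: implies0_trans (implies0_preimage mf PQg) (implies0_eq0 _ gf).
Qed.

(** The join is taken among all affine partitions, measurable or not. This
    is possible because the join on [X] is the actual common refinement
    mod 0, so that its defining property is a pointwise one. *)
Lemma join_affine_model P Q J :
  measurable_partition mu P -> measurable_partition mu Q ->
  is_join0 mu (measurable_partition mu) P Q J ->
  is_join0 nu (@affine_partition R F)
    (affine_model P) (affine_model Q) (affine_model J).
Proof.
move=> mP mQ jJ; have [mJ JP JQ _] := jJ; split.
- exact: affine_model_affine.
- exact/refines0_affine_model.
- exact/refines0_affine_model.
- move=> J' _ J'P J'Q.
  apply: implies0_trans _ (to_model mJ).
  apply: implies0_trans (implies0_preimage mg (join_same_element mP mQ jJ)).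
  have [Z fZ hP] := implies0_trans J'P (of_model mP).
  have [Z' fZ' hQ] := implies0_trans J'Q (of_model mQ).
  exists (Z `&` Z'); first exact: fullI.
  by move=> x y [Zx Z'x] [Zy Z'y] xy; split; [exact: hP|exact: hQ].
Qed.

(** A measurable affine partition below both models pulls back along [f] to a
    measurable partition of [X], to which the maximality of [M] applies. *)
Lemma meet_affine_model P Q M :
  measurable_partition mu P -> measurable_partition mu Q ->
  is_meet0 mu (measurable_partition mu) P Q M ->
  is_meet0 nu (@measurable_affine_partition R F)
    (affine_model P) (affine_model Q) (affine_model M).
Proof.
move=> mP mQ [mM PM QM Mmax]; split.
- exact: affine_model_measurable.
- exact/refines0_affine_model.
- exact/refines0_affine_model.
move=> M' [_ [N mN [Z fZ M'N]]] PM' QM'.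
have [B mB NB] := measurable_partitionP mN.
pose K := fibers (fun n => f @^-1` B n).
have mK : measurable_partition mu K.
  by apply: measurable_fibers => n; exact: mp0_measurable0 mf (mB n).
have KE x y : same_element K x y <-> same_element N (f x) (f y).
  apply: iff_trans (same_element_fibers _ _ _) _; by apply: iff_sym; exact: NB.
have M'leN : refines0 nu M' N.
  by exists Z => // x y Zx Zy; case: (M'N x y Zx Zy).
have toK P' : measurable_partition mu P' -> refines0 nu (affine_model P') M' ->
    refines0 mu P' K.
  move=> mP' P'M'.
  have P'N := implies0_trans (to_model mP') (implies0_trans P'M' M'leN).
  apply: implies0_trans (implies0_eq0 (same_element P') (eq0_sym gf)) _.
  apply: implies0_trans (implies0_preimage mf P'N) _.
  by apply: implies0W => x y /KE.
have MK := Mmax _ mK (toK _ mP PM') (toK _ mQ QM').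
apply: implies0_trans (of_model mM) _.
apply: implies0_trans (implies0_preimage mg MK) _.
apply: implies0_trans (_ : implies0 nu _
  (fun x y => same_element N (f (g x)) (f (g y)))) _.
  by apply: implies0W => x y /KE.
apply: implies0_trans (implies0_eq0 (same_element N) fg) _.
by exists Z => // x y Zx Zy; case: (M'N x y Zx Zy).
Qed.

End transfer.

Theorem theorem4 (R : realType) :
  (* 1. every vector measure space is a linear isomorphic mod 0 image of a
     space with a free measure, continuous as soon as the given one is; *)
  (forall V : vmspace R, exists F : vmspace R,
     [/\ free_measure F,
         atomless (vmeasure V) -> atomless (vmeasure F) &
         linear_iso0_image F V])
  (* universality of a free continuous measure *)
  /\ (exists F : vmspace R, free_measure F /\ atomless (vmeasure F))
  /\ (forall F : vmspace R, free_measure F -> atomless (vmeasure F) ->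
      forall V : vmspace R,
        (exists f : F -> V, vm_morphism f) /\
        (atomless (vmeasure V) -> linear_iso0_image F V))
  (* 2. automorphisms are linear mod 0; *)
  /\ (forall F : vmspace R, free_measure F ->
      forall T : F -> F, automorphism0 (vmeasure F) T ->
      exists T' : F -> F,
        linear_automorphism T' /\ eq0 (vmeasure F) T T')
  (* an injective homomorphism from the group of automorphism classes to the
     group of classes of linear automorphisms *)
  /\ (forall (d : measure_display) (X : measurableType d)
        (mu : probability X R), lebesgue_rokhlin mu -> atomless mu ->
      forall F : vmspace R, free_measure F -> atomless (vmeasure F) ->
      exists Phi : (X -> X) -> (F -> F),
        [/\ forall S, automorphism0 mu S -> linear_automorphism (Phi S),
            forall S T, automorphism0 mu S -> automorphism0 mu T ->
              eq0 (vmeasure F) (Phi (S \o T)) (Phi S \o Phi T) &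
            forall S T, automorphism0 mu S -> automorphism0 mu T ->
              (eq0 mu S T <-> eq0 (vmeasure F) (Phi S) (Phi T))])
  (* 3. measurable partitions are affine mod 0; *)
  /\ (forall F : vmspace R, free_measure F ->
      forall P : set (set F), measurable_partition (vmeasure F) P ->
      exists L : set F,
        subspace_of L /\ eq_partition0 (vmeasure F) P (cosets L))
  (* the classes of measurable partitions form a lattice, embedded in the
     classes of affine partitions *)
  /\ (forall (d : measure_display) (X : measurableType d)
        (mu : probability X R), lebesgue_rokhlin mu -> atomless mu ->
      (forall P Q : set (set X),
         measurable_partition mu P -> measurable_partition mu Q ->
         (exists J, is_join0 mu (measurable_partition mu) P Q J) /\
         (exists M, is_meet0 mu (measurable_partition mu) P Q M)) /\
      forall F : vmspace R, free_measure F -> atomless (vmeasure F) ->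
      exists Theta : set (set X) -> set (set F),
        [/\ forall P, measurable_partition mu P ->
              measurable_affine_partition (Theta P),
            forall P Q, measurable_partition mu P ->
              measurable_partition mu Q ->
              (refines0 mu P Q <->
               refines0 (vmeasure F) (Theta P) (Theta Q)),
            forall P Q J, measurable_partition mu P ->
              measurable_partition mu Q ->
              is_join0 mu (measurable_partition mu) P Q J ->
              is_join0 (vmeasure F) (@affine_partition R F)
                (Theta P) (Theta Q) (Theta J) &
            forall P Q M, measurable_partition mu P ->
              measurable_partition mu Q ->
              is_meet0 mu (measurable_partition mu) P Q M ->
              is_meet0 (vmeasure F) (@measurable_affine_partition R F)
                (Theta P) (Theta Q) (Theta M)]).
Proof.
split=> [V|].
  have [F [f [freeF isof]]] := lebesgue_rokhlin_curve (vlebesgue V).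
  exists F; split=> // [atV|].
    by have [g [isog _ _]] := iso0_sym isof; exact: iso0_atomless isog atV.
  have [Y fY indY] := free_independent freeF.
  exact: (lin_ext_iso0_image fY indY isof).
split.
  exists (curve_vmspace (unit_standard R)); split; first exact: curve_free.
  have [g [isog _ _]] := iso0_sym (curve_iso0 (unit_measure R)).
  exact: iso0_atomless isog (@unit_atomless R).
split=> [F freeF atF V|].
  split; first exact: curve_morphism.
  move=> atV; have [Y fY indY] := free_independent freeF.
  have [f isof] := atomless_iso0 (vlebesgue F) atF (vlebesgue V) atV.
  exact: (lin_ext_iso0_image fY indY isof).
split=> [F freeF T aT|].
  have [Y fY indY] := free_independent freeF.
  exists (lin_ext Y T); split; first exact: lin_ext_automorphism.
  exact: lin_ext_eq0.
split=> [d X mu Lmu amu F freeF atF|].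
  have [Y fY indY] := free_independent freeF.
  have [f [mf [g [mg gf fg]]]] := atomless_iso0 Lmu amu (vlebesgue F) atF.
  exact: (linear_automorphism_transfer fY indY mf mg gf fg).
split=> [F freeF P mP|].
  have [Y fY indY] := free_independent freeF.
  have [rP sP tP] := same_element_equiv mP.
  exists (class_space Y (@same_element _ (vborel (@vhom _ F)) P)).
  split; first exact: class_space_subspace.
  exists Y => // x y Yx Yy; apply: iff_sym.
  exact: (@same_element_class_space _ F).
move=> d X mu Lmu amu; split=> [P Q mP mQ|F freeF atF].
  split; first by have [J jJ _] := join_exists mP mQ; exists J.
  exact: meet_exists (lebesgue_rokhlin_separable Lmu).
have [Y fY indY] := free_independent freeF.
have [f [mf [g [mg gf fg]]]] := atomless_iso0 Lmu amu (vlebesgue F) atF.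
exists (affine_model Y g); split=> [P mP|P Q mP mQ|P Q J mP mQ|P Q M mP mQ].
- exact: (affine_model_measurable fY indY mg mP).
- exact: (refines0_affine_model fY indY mf mg gf).
- exact: (join_affine_model fY indY mf mg gf mP mQ).
- exact: (meet_affine_model fY indY mf mg gf fg mP mQ).
Qed.
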